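(* Let $k\geq 1$ be an odd integer and let $G$ be a connected graph of even order $n\geq 6$. (i) If $6\le n\le 8$ and $\lambda_1(D(G))\le \lambda_1(D(S_{n,\frac{n}{2}-1}))$, then $G$ has a perfect $k$-matching unless $G\cong S_{n,\frac{n}{2}-1}$. (ii) If $n\geq 10$ and $\lambda_1(D(G))\le \lambda_1(D(K_1\vee(K_{n-3}\cup 2K_1)))$, then $G$ has a perfect $k$-matching unless $G\cong K_1\vee(K_{n-3}\cup 2K_1)$.
   Context: All graphs are finite, simple, undirected. For a connected graph $G$ with vertices $v_1,\dots,v_n$, the distance matrix $D(G)$ is the $n\times n$ matrix whose $(i,j)$-entry is the distance $d_G(v_i,v_j)$; $\lambda_1(D(G))$ denotes its largest eigenvalue (the distance spectral radius). $G\cup H$ is the disjoint union, $G\vee H$ the join (disjoint union plus all edges between $V(G)$ and $V(H)$), $tK_1$ is the edgeless graph on $t$ vertices, and $S_{n,k}=K_k\vee (n-k)K_1$. For a vertex $v$, $E_G(v)$ is the set of edges incident with $v$. A $k$-matching of $G$ is a function $f:E(G)\to\{0,1,\dots,k\}$ with $\sum_{e\in E_G(v)}f(e)\le k$ for every $v\in V(G)$; it is perfect if $\sum_{e\in E_G(v)}f(e)=k$ for every $v\in V(G)$. *)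

(* Defs.v *)
From HB Require Import structures.
From mathcomp Require Import all_boot all_order all_fingroup all_algebra.
From mathcomp Require Import reals.
Set Implicit Arguments. Unset Strict Implicit. Unset Printing Implicit Defensive.
Import Order.TTheory GRing.Theory Num.Theory.

Definition simple_graph n (adj : rel 'I_n) :=
  symmetric adj /\ irreflexive adj.

Definition connected_graph n (adj : rel 'I_n) :=
  forall u v : 'I_n, connect adj u v.

Fixpoint reach_within n (adj : rel 'I_n) (m : nat) (u v : 'I_n) : bool :=
  match m with
  | 0 => u == v
  | m'.+1 => reach_within adj m' u v || [exists w, adj u w && reach_within adj m' w v]
  end.

(* graph distance: the least m such that v is reachable from u within m steps
   (for a connected graph on n vertices this is < n) *)
Definition dist n (adj : rel 'I_n) (u v : 'I_n) : nat :=
  find (fun m => reach_within adj m u v) (iota 0 n).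

Definition dist_mx (R : realType) n (adj : rel 'I_n) : 'M[R]_n :=
  \matrix_(i, j) ((dist adj i j)%:R)%R.

Definition largest_eigenvalue (R : realType) n (A : 'M[R]_n) (l : R) :=
  eigenvalue A l /\ (forall mu, eigenvalue A mu -> (mu <= l)%R).

Definition graph_iso n (adj1 adj2 : rel 'I_n) :=
  exists f : {perm 'I_n}, forall x y, adj1 x y = adj2 (f x) (f y).

Definition perfect_k_matching n (adj : rel 'I_n) (k : nat) :=
  exists f : 'I_n -> 'I_n -> nat,
    [/\ forall u v, f u v = f v u,
        forall u v, ~~ adj u v -> f u v = 0,
        forall u v, f u v <= k
      & forall v, \sum_(u < n) f v u = k].

(* S_{n,k} = K_k \/ (n-k)K_1 : vertices < k form the clique K_k *)
Definition S_graph n (k : nat) : rel 'I_n :=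
  fun i j => (i != j) && ((i < k) || (j < k)).

(* K_1 \/ (K_{n-3} U 2K_1): vertex 0 is the K_1, vertices 1..n-3 form K_{n-3},
   vertices n-2, n-1 are the two isolated vertices of 2K_1 *)
Definition K1_join_Kn3_2K1 n : rel 'I_n :=
  fun i j => (i != j) &&
    [|| (i : nat) == 0, (j : nat) == 0 | ((i <= n - 3) && (j <= n - 3))].

(* Main.v *)
Require Import Defs.
From HB Require Import structures.
From mathcomp Require Import all_boot all_order all_fingroup all_algebra.
From mathcomp Require Import reals.
From mathcomp Require Import boolp complex zify ring lra.
Set Implicit Arguments. Unset Strict Implicit. Unset Printing Implicit Defensive.
Import Order.TTheory GRing.Theory Num.Theory.

(** A perfect matching [M] gives the perfect [k]-matching [k * 1_M], so it is
    enough to find a perfect matching. If there is none, Tutte's theorem (proved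
    by Lovász's argument on edge-maximal graphs) yields a nonempty set [S] and a
    partition [P] of its complement into at least [#|S| + 2] blocks with no edge
    between distinct blocks. Vertices of distinct blocks are at distance at least
    2, so the Rayleigh quotient of [D(G)] at a nonnegative vector [x] bounds
    [lambda_1(D(G))] from below through the block sizes only. The constant vector
    suffices except for a few configurations with almost all blocks singletons,
    where [x] gets weight 3 on the singleton blocks and 2 elsewhere. In the
    extremal configuration [G] is a spanning subgraph of the extremal graph, and
    the positive Perron vector of the latter shows that deleting an edge strictly
    increases [lambda_1]. The extremal [lambda_1] is bounded above through the
    quadratic or cubic equation of the quotient matrix. *)

(** * Tutte's theorem *)

(** A perfect matching of the subgraph induced on [A], given as a partner function. Its values
    outside [A] are free, so pairings of disjoint sets glue by a case distinction. *)
Definition pairing_on {T : finType} (e : rel T) (A : {set T}) (m : T -> T) :=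
  forall v, v \in A -> [/\ m v \in A, m (m v) = v & e v (m v)].

Definition matchable {T : finType} (e : rel T) (A : {set T}) :=
  exists m, pairing_on e A m.

Lemma matchable0 (T : finType) (e : rel T) : matchable e set0.
Proof. by exists id => v; rewrite inE. Qed.

Lemma matchable2 (T : finType) (e : rel T) (a b : T) :
  symmetric e -> e a b -> matchable e [set a; b].
Proof.
move=> es eab; exists (fun v => if v == a then b else a) => v.
rewrite !inE => /orP[] /eqP ->; rewrite ?eqxx ?orbT.
  by split=> //; case: eqP.
by case: (b =P a) eab => [->|_] eab; rewrite ?eqxx ?orbT //; split; rewrite // es.
Qed.

Lemma matchableU (T : finType) (e : rel T) (A B : {set T}) :
  [disjoint A & B] -> matchable e A -> matchable e B -> matchable e (A :|: B).
Proof.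
move=> dAB [m1 h1] [m2 h2]; exists (fun v => if v \in A then m1 v else m2 v) => v.
rewrite inE; case: ifP => [vA _|vA /= vB].
  by have [mA -> evm] := h1 v vA; rewrite inE mA.
have [mB mmv evm] := h2 v vB.
by rewrite inE mB orbT mmv (disjointFl dAB mB).
Qed.

Lemma pairing_even (T : finType) (e : rel T) (A : {set T}) m :
  irreflexive e -> pairing_on e A m -> ~~ odd #|A|.
Proof.
move=> ei; have [n] := ubnP #|A|; elim: n A => // n IHn A ltAn pA.
have [->|[a aA]] := set_0Vmem A; first by rewrite cards0.
have [maA mma ea] := pA a aA.
have nma : m a != a by apply: contraTneq ea => ->; rewrite ei.
have cA : #|A| = (#|A :\ a :\ m a|).+2.
  by rewrite (cardsD1 a) aA (cardsD1 (m a) (A :\ a)) !inE nma maA.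
rewrite cA /= negbK; apply: IHn => [|v].
  by rewrite cA in ltAn; apply: ltnW.
rewrite !inE => /and3P[vma va vA]; have [mvA mmv ev] := pA v vA.
split=> //; rewrite mvA andbT; apply/andP; split; apply: contraNneq vma.
  by move=> /(congr1 m); rewrite mmv mma => eva; rewrite eva eqxx in va.
by move=> <-; rewrite mmv.
Qed.

Lemma matchable_clique (T : finType) (e : rel T) (A : {set T}) :
  symmetric e -> {in A &, forall u v, u != v -> e u v} -> ~~ odd #|A| ->
  matchable e A.
Proof.
move=> es; have [n] := ubnP #|A|; elim: n A => // n IHn A ltAn cA evA.
have [->|[a aA]] := set_0Vmem A; first exact: matchable0.
have [A0|[b bA]] := set_0Vmem (A :\ a).
  by move: evA; rewrite (cardsD1 a) aA A0 cards0.
have ncA : #|A| = (#|A :\ a :\ b|).+2.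
  by rewrite (cardsD1 a) aA (cardsD1 b (A :\ a)) bA.
have defA : A = [set a; b] :|: (A :\ a :\ b).
  apply/setP=> v; rewrite !inE; have [->|va] := eqVneq v a; first by rewrite aA.
  by have [->|//] := eqVneq v b; move: bA; rewrite !inE => /andP[].
move: bA; rewrite !inE => /andP[nba bA].
rewrite defA; apply: matchableU.
- by rewrite -setI_eq0; apply/eqP/setP=> v; rewrite !inE; do 2!case: eqP.
- by apply: matchable2 => //; apply: cA; rewrite // eq_sym.
apply: IHn; first by rewrite ncA in ltAn; apply: ltnW.
  by move=> u v; rewrite !inE => /and3P[_ _ uA] /and3P[_ _ vA]; apply: cA.
by move: evA; rewrite ncA /= negbK.
Qed.

(** Each vertex of [R] takes a partner in [U]; what is left of [U] is a clique of even size. The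
    induction removes one such pair at a time. *)
Lemma matchable_join (T : finType) (e : rel T) (R U : {set T}) :
  symmetric e -> [disjoint R & U] -> {in U &, forall u v, u != v -> e u v} ->
  {in R & U, forall r u, e r u} -> #|R| <= #|U| -> ~~ odd (#|R| + #|U|) ->
  matchable e (R :|: U).
Proof.
move=> es; move nR : #|R| => n; elim: n R U nR => [|n IHn] R U nR dRU cU jRU leRU ev.
  move/eqP: nR; rewrite cards_eq0 => /eqP ->; rewrite set0U.
  exact: matchable_clique.
have [r rR] : exists r, r \in R by apply/set0Pn; rewrite -card_gt0 nR.
have [u uU] : exists u, u \in U.
  by apply/set0Pn; rewrite -card_gt0; apply: leq_ltn_trans leRU.
have cR : #|R :\ r| = n by move: nR; rewrite (cardsD1 r) rR => -[].
have cU' : #|U| = (#|U :\ u|).+1 by rewrite (cardsD1 u) uU.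
have uR : u \notin R by rewrite (disjointFl dRU).
have rU : r \notin U by rewrite (disjointFr dRU).
have -> : R :|: U = [set r; u] :|: (R :\ r :|: U :\ u).
  apply/setP=> v; rewrite !inE; have [->|vr] := eqVneq v r; first by rewrite rR.
  by have [->|//] := eqVneq v u; rewrite uU orbT.
apply: matchableU.
- rewrite -setI_eq0; apply/eqP/setP=> v; rewrite !inE.
  have [->|vr] := eqVneq v r; first by rewrite (negPf rU) andbF.
  by have [->|//] := eqVneq v u; rewrite (negPf uR).
- exact/matchable2/jRU.
apply: IHn => //.
- by apply: disjointWl (subsetDl _ _) _; apply: disjointWr (subsetDl _ _) _.
- by move=> v w; rewrite !inE => /andP[_ vU] /andP[_ wU]; apply: cU.
- by move=> v w; rewrite !inE => /andP[_ vU] /andP[_ wU]; apply: jRU.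
- by rewrite cU' in leRU.
- by move: ev; rewrite cU' addSn addnS /= negbK.
Qed.

(** [R] is what remains after greedily deleting adjacent pairs from [A], that is, the vertices
    missed by a maximal matching of [A]. *)
Lemma matchable_reduce (T : finType) (e : rel T) (A : {set T}) :
  symmetric e -> exists R : {set T},
    [/\ R \subset A, {in R &, forall u v, u != v -> ~~ e u v}
      & matchable e (A :\: R)].
Proof.
move=> es; have [n] := ubnP #|A|; elim: n A => // n IHn A ltAn.
have [|indA] := boolP [exists u in A, exists v in A, (u != v) && e u v]; last first.
  exists A; split; rewrite ?setDv; [by [] | | exact: matchable0].
  move=> u v uA vA uv; apply: contra indA => euv; apply/exists_inP; exists u => //.
  by apply/exists_inP; exists v; rewrite // uv.
case/exists_inP=> a aA /exists_inP[b bA /andP[ab eab]].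
have ncA : #|A| = (#|A :\ a :\ b|).+2.
  by rewrite (cardsD1 a) aA (cardsD1 b (A :\ a)) !inE eq_sym ab bA.
have [|R [sRA iR mR]] := IHn (A :\ a :\ b).
  by rewrite ncA in ltAn; apply: ltnW.
have sRA' v : v \in R -> [/\ v != a, v != b & v \in A].
  by move/(subsetP sRA); rewrite !inE => /and3P[? ? ?]; split.
exists R; split=> //; first by apply/subsetP=> v /sRA'[].
have -> : A :\: R = [set a; b] :|: (A :\ a :\ b :\: R).
  have aR : a \notin R by apply/negP => /sRA'[]; rewrite eqxx.
  have bR : b \notin R by apply/negP => /sRA'[]; rewrite eqxx.
  apply/setP=> v; rewrite !inE; have [->|va] := eqVneq v a; first by rewrite aA aR.
  by have [->|//] := eqVneq v b; rewrite bA bR.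
apply: matchableU => //; last exact: matchable2.
rewrite -setI_eq0; apply/eqP/setP=> v; rewrite !inE.
by do 2!case: eqP => ? /=; rewrite ?andbF.
Qed.

(* Walk from [z] along the alternating cycle of [m1] and [m2], starting with
   [m2]: the odd-length stretch up to [y], minus [y], is matched by [m2], the
   freed vertices [x] and [y] are matched together, and [m1] does the rest. *)
Lemma alternating_reach (T : finType) (e : rel T) (m1 m2 : T -> T) (x y z w : T) :
  symmetric e -> involutive m1 -> involutive m2 ->
  (forall v, m1 v != v) -> (forall v, m2 v != v) ->
  m1 z = x -> m2 y = w -> e x y -> y != z ->
  (forall v, v != x -> v != z -> e v (m1 v)) ->
  (forall v, v != y -> v != w -> e v (m2 v)) ->
  fconnect (m1 \o m2) z y -> matchable e setT.
Proof.
move=> es i1 i2 f1 f2 m1z m2y exy yz e1 e2 /iter_findex.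
set p := m1 \o m2; set j := findex _ _ _ => pj.
have pinj : injective p := inj_comp (inv_inj i1) (inv_inj i2).
(* [j] is the first time the orbit of [z] meets [y]. *)
have minj i : i < j -> iter i p z != y.
  move=> lij; apply: contraTneq lij => pi; rewrite -leqNgt /j -pi.
  have [le1|lt1] := leqP (fingraph.order p z) i.
    by apply/ltnW/(leq_trans _ le1)/findex_max/fconnect_iter.
  by rewrite findex_iter.
(* The orbit of [z] avoids its own [m2]-image: an equality can be moved inwards, shrinking the gap
   between the exponents, until [m1] or [m2] has a fixed point. *)
have par a b : iter a p z != m2 (iter b p z).
  wlog leba : a b / b <= a => [Hw|].
    have [/Hw//|/ltnW/Hw] := leqP b a.
    by apply: contraNneq => ->; rewrite i2.
  have [n] := ubnP (a - b); elim: n a b leba => // n IHn a b leba ltn.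
  case: (ltngtP a b) leba => // [ltba _|-> _]; last by rewrite eq_sym f2.
  case: a ltba ltn => // a; rewrite ltnS leq_eqVlt => /orP[/eqP <- _|ltba ltn].
    by rewrite /= f1.
  apply: contraNneq (IHn a b.+1 ltba _) => [|].
    by move/(congr1 m1); rewrite /= i1 => mE; rewrite -[p (iter b _ _)]/(m1 (m2 _)) -mE i2 eqxx.
  by lia.
(* The stretch walked: the orbit points before [y] and their [m2]-partners. *)
pose A := [pred v | [exists i : 'I_j, (v == iter i p z) || (v == m2 (iter i p z))]].
have AP v : reflect (exists2 i, i < j & v = iter i p z \/ v = m2 (iter i p z)) (A v).
  apply: (iffP existsP) => [[i /orP[] /eqP ->]|[i lij vE]].
  - by exists i; [|left].
  - by exists i; [|right].
  by exists (Ordinal lij); case: vE => ->; rewrite eqxx ?orbT.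
have Am2 v : A v -> A (m2 v).
  by case/AP=> i lij [] ->; apply/AP; exists i; rewrite ?i2; auto.
have Ay : ~~ A y.
  apply/AP=> -[i lij [yE|yE]]; first by have /eqP[] := minj i lij.
  by have /eqP[] := par j i; rewrite pj.
have Ax : ~~ A x.
  apply/AP=> -[[|i] lij [xE|xE]].
  - by have /eqP[] := f1 z; rewrite m1z.
  - move: xE; rewrite -m1z => /(congr1 m1); rewrite i1 => zE.
    have zp : p z = z := esym zE.
    have [j1|j1] := eqVneq j 1; first by have /eqP[] := yz; rewrite -pj j1 /= zp.
    have pz k : iter k p z = z by elim: k => // k IHk; rewrite iterSr zp.
    by have /eqP[] := yz; rewrite -pj pz.
  - by have /eqP[] := par 0 i; rewrite -[LHS]i1 m1z xE iterS /= i1.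
  (* Here [z] returns after [i.+2 <= j] steps, so [y] would be met before step [j]. *)
  have zE : z = iter i.+2 p z by rewrite -[LHS]i1 m1z xE.
  have ltj : j - i.+2 < j by lia.
  by have /eqP[] := minj _ ltj; rewrite [in LHS]zE -iterD subnK.
have j0 : 0 < j by rewrite lt0n; apply: contraNneq yz => j0; rewrite -pj j0.
have Az : A z by apply/AP; exists 0; auto.
have Am1 v : A v -> v != z -> A (m1 v) \/ m1 v = y.
  case/AP=> i lij [] ->.
    case: i lij => [|i] lij; rewrite ?eqxx // => _; left.
    by rewrite iterS /p /= i1; apply/AP; exists i; [apply: ltnW | right].
  move=> _; rewrite -[m1 _]/(iter i.+1 p z).
  move: lij; rewrite leq_eqVlt => /orP[/eqP ->|lij]; [by right | left].
  by apply/AP; exists i.+1; auto.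
have m1y : A (m1 y).
  rewrite -pj -(prednK j0) iterS /p /= i1.
  by apply/AP; exists j.-1; [rewrite ltn_predL | right].
exists (fun v => if A v then m2 v else if v == x then y else if v == y then x else m1 v).
move=> v _; split; first by rewrite inE.
  have [Av|nAv] := boolP (A v); first by rewrite Am2.
  have [->|vx] := eqVneq v x.
    by rewrite (negPf Ay) eqxx; case: eqP.
  have [->|vy] := eqVneq v y; first by rewrite (negPf Ax) eqxx.
  have [Am|nAm] := boolP (A (m1 v)).
    have [m1v|m1v] := eqVneq (m1 v) z; first by rewrite -m1z -m1v i1 eqxx in vx.
    by case: (Am1 _ Am m1v); rewrite i1 => Hv; [rewrite Hv in nAv | rewrite Hv eqxx in vy].
  have [m1x|_] := eqVneq (m1 v) x.
    by move: nAv; rewrite -[v]i1 m1x -m1z i1 Az.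
  have [m1v|_] := eqVneq (m1 v) y; last exact: i1.
  by move: nAv; rewrite -[v]i1 m1v m1y.
have [Av|nAv] := boolP (A v).
  apply: e2; first by apply: contraNneq Ay => <-.
  by apply: contraNneq Ay => vw; rewrite -[y]i2 m2y -vw; apply: Am2.
have [->//|vx] := eqVneq v x.
have [->|vy] := eqVneq v y; first by rewrite es.
by apply: e1 => //; apply: contraNneq nAv => ->.
Qed.

(** Lovász's exchange: [xz] and [yw] are the only pairs of [m1] and [m2] that may be non-edges. If
    the alternating cycle through [xz] misses [y], using [m2] on it and [m1] elsewhere avoids both;
    otherwise [alternating_reach] applies from [z] or from [x]. *)
Lemma alternating_switch (T : finType) (e : rel T) (m1 m2 : T -> T) (x y z w : T) :
  symmetric e -> involutive m1 -> involutive m2 ->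
  (forall v, m1 v != v) -> (forall v, m2 v != v) ->
  m1 x = z -> m2 y = w -> e x y -> e y z -> x != y -> y != z ->
  (forall v, v != x -> v != z -> e v (m1 v)) ->
  (forall v, v != y -> v != w -> e v (m2 v)) ->
  matchable e setT.
Proof.
move=> es i1 i2 f1 f2 m1x m2y exy eyz xy yz e1 e2.
have m1z : m1 z = x by rewrite -m1x i1.
set p := m1 \o m2.
have pinj : injective p := inj_comp (inv_inj i1) (inv_inj i2).
have [zy|nzy] := boolP (fconnect p z y).
  exact: (@alternating_reach _ e m1 m2 x y z w).
have [xy'|nxy] := boolP (fconnect p x y).
  apply: (@alternating_reach _ e m1 m2 z y x w) => //; first by rewrite es.
    by rewrite eq_sym.
  by move=> v vz vx; apply: e1.
have sp := fconnect_sym pinj.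
(* Conjugation by [m1] inverts [p], so [m1] permutes the orbits of [p]. *)
have pm1 a b : fconnect p a b -> fconnect p (m1 a) (m1 b).
  move=> /iter_findex <-; elim: (findex _ _ _) => [|i IHi] /=; first exact: connect0.
  by apply: (connect_trans IHi); rewrite sp; apply: connect1; rewrite /p /= !i1 i2.
pose C v := fconnect p z v || fconnect p x v.
have C1 v : C v -> C (m1 v).
  by case/orP=> /pm1; rewrite ?m1z ?m1x /C => ->; rewrite ?orbT.
have Cp v : C v -> C (p v).
  by case/orP=> Hv; rewrite /C (connect_trans Hv (fconnect1 p v)) ?orbT.
have C2 v : C v -> C (m2 v) by move=> Cv; rewrite -[m2 v]i1; apply/C1/Cp.
have Cz : C z by rewrite /C connect0.
have Cx : C x by rewrite /C connect0 orbT.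
have nCy : ~~ C y by rewrite negb_or nzy nxy.
exists (fun v => if C v then m2 v else m1 v) => v _; split; first by rewrite inE.
  have [Cv|nCv] := boolP (C v); first by rewrite (C2 _ Cv).
  case: ifP => [/C1|_]; last exact: i1.
  by rewrite i1 (negPf nCv).
have [Cv|nCv] := boolP (C v).
  apply: e2; first by apply: contraNneq nCy => <-.
  by apply: contraNneq nCy => vw; rewrite -[y]i2 m2y -vw; apply: C2.
by apply: e1; apply: contraNneq nCv => ->.
Qed.

Definition add_edge {T : finType} (e : rel T) (x z : T) : rel T :=
  fun u v => [|| e u v, (u == x) && (v == z) | (u == z) && (v == x)].

(* The edge [xz] must be used by the new pairing. *)
Lemma pairing_add_edge (T : finType) (e : rel T) (x z : T) m :
  irreflexive e -> x != z -> ~ matchable e setT ->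
  pairing_on (add_edge e x z) setT m ->
  [/\ involutive m, forall v, m v != v, m x = z
    & forall v, v != x -> v != z -> e v (m v)].
Proof.
move=> ei xz nM pm.
have im : involutive m by move=> v; case: (pm v (in_setT v)).
have em v : v != x -> v != z -> e v (m v).
  by case: (pm v (in_setT v)) => _ _; rewrite /add_edge => /or3P[//|/andP[->]|/andP[-> //]].
split=> // [v|].
  apply/eqP=> mv; case: (pm v (in_setT v)) => _ _; rewrite mv /add_edge ei /=.
  by rewrite andbC orbb; apply/negP/andP=> -[/eqP-> /eqP zx]; rewrite zx eqxx in xz.
apply/eqP/negPn/negP=> mxz; apply: nM; exists m => v _.
have [_ _ ev] := pm v (in_setT v); split; rewrite ?inE //.
case/or3P: ev => // /andP[/eqP vE /eqP mvE].
  by rewrite -vE mvE eqxx in mxz.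
by rewrite -mvE im vE eqxx in mxz.
Qed.

(** A violation of Tutte's condition. Blocks are only required to be unions of components outside
    [S], so a barrier survives the deletion of edges. *)
Definition barrier {T : finType} (e : rel T) (S : {set T}) (P : {set {set T}}) :=
  [/\ partition P (~: S),
      forall u v, u \notin S -> v \notin S -> e u v -> pblock P u = pblock P v
    & #|S| < #|[set B in P | odd #|B|]|].

(** In an edge-maximal graph without perfect matching, the set [U] of vertices adjacent to all
    others is a barrier: outside [U] adjacency is transitive, so the blocks are cliques. *)
Lemma saturated_barrier (T : finType) (e : rel T) :
  symmetric e -> irreflexive e -> ~~ odd #|T| -> ~ matchable e setT ->
  (forall x z, x != z -> ~~ e x z -> matchable (add_edge e x z) setT) ->
  exists S P, barrier e S P.
Proof.
move=> es ei evT nM sat.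
pose U := [set u | [forall v, (v != u) ==> e u v]].
pose r := [rel u v | (u == v) || e u v].
have UP u : reflect (forall v, v != u -> e u v) (u \in U).
  by rewrite inE; apply: (iffP forallP) => H v; apply/implyP/H.
(* If [ac] were missing, then [b], being outside [U], also misses some [w]; the pairings obtained by
   adding [ac] and by adding [bw] are merged by [alternating_switch]. *)
have tr a b c : b \notin U -> e a b -> e b c -> a != c -> e a c.
  move=> bU eab ebc ac; apply/negPn/negP=> neac; apply: (nM).
  have /existsP[w] : [exists w, (b != w) && ~~ e b w].
    apply: contraNT bU => /existsPn H; apply/UP=> v vb.
    by have := H v; rewrite eq_sym vb negbK.
  case/andP=> bw nebw.
  have [m1 pm1] := sat a c ac neac; have [m2 pm2] := sat b w bw nebw.
  have [i1 f1 m1a e1] := pairing_add_edge ei ac nM pm1.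
  have [i2 f2 m2b e2] := pairing_add_edge ei bw nM pm2.
  have ab : a != b by apply: contraTneq eab => ->; rewrite ei.
  have bc : b != c by apply: contraTneq ebc => ->; rewrite ei.
  exact: (@alternating_switch _ e m1 m2 a b c w).
have rE : {in ~: U & &, equivalence_rel r}.
  move=> a b c; rewrite !in_setC => aU bU cU; split=> /=; first by rewrite eqxx.
  case/orP=> [/eqP->//|eab]; apply/orP/orP=> -[/eqP E|H].
  - by right; rewrite -E es.
  - by have [|bc] := eqVneq b c; [left | right; rewrite (tr b a c) // es].
  - by right; rewrite -E.
  - by have [|ac] := eqVneq a c; [left | right; rewrite (tr a b c)].
pose P := equivalence_partition r (~: U).
have partP : partition P (~: U) by apply: equivalence_partitionP.
have pbE : {in ~: U &, forall a b, (b \in pblock P a) = r a b}.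
  exact: pblock_equivalence_partition.
have tiP : trivIset P by case/and3P: partP.
have covP : cover P = ~: U by apply: cover_partition.
have pb_e u v : u \in ~: U -> v \in ~: U -> e u v -> pblock P u = pblock P v.
  move=> uU vU euv; apply/esym/same_pblock => //.
  by rewrite pbE //= euv orbT.
exists U, P; split=> //.
  by move=> u v uU vU; apply: pb_e; rewrite inE.
have [R [sRU iR mR]] := matchable_reduce (~: U) es.
have ltUR : #|U| < #|R|.
  (* Otherwise [R] can be absorbed by [U], which extends the pairing of the rest to all vertices. *)
  rewrite ltnNge; apply: contra_notN nM => leRU.
  have dRU : [disjoint R & U].
    by rewrite disjoints_subset.
  have dKU : [disjoint ~: U :\: R & R :|: U].
    rewrite -setI_eq0; apply/eqP/setP=> v; rewrite !inE.
    by case: (v \in R); case: [forall _, _].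
  have <- : (~: U :\: R) :|: (R :|: U) = setT.
    apply/setP=> v; rewrite !inE.
    by case: (v \in R); case: [forall _, _].
  have evRU : ~~ odd (#|R| + #|U|).
    have cT : #|T| = #|~: U :\: R| + (#|R| + #|U|).
      by rewrite -(cardsC U) (cardsD (~: U) R) (setIidPr sRU);
         have := subset_leq_card sRU; lia.
    by case: mR => m /(pairing_even ei); move: evT; rewrite cT oddD; case: (odd _).
  apply: matchableU => //; apply: matchable_join => //.
    by move=> u v /UP uU _; rewrite eq_sym => /uU.
  move=> a u aR uU; rewrite es; apply: (elimT (UP u) uU).
  by apply: contraTneq aR => ->; rewrite (disjointFl dRU).
apply: leq_trans ltUR _.
(* Blocks are cliques, so the independent set [R] meets each at most once; the rest of a block met
   by [R] is paired inside it, hence that block is odd. *)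
have injR : {in R &, injective (pblock P)}.
  move=> a b aR bR eqab; apply/eqP/negPn/negP=> ab.
  have := iR a b aR bR ab; have: b \in pblock P a.
    by rewrite eqab mem_pblock covP (subsetP sRU).
  by rewrite pbE ?(subsetP sRU) //= (negPf ab) /= => ->.
rewrite -(card_in_imset injR); apply/subset_leq_card/subsetP=> _ /imsetP[a aR ->].
have aU := subsetP sRU _ aR.
rewrite inE pblock_mem ?covP // (cardsD1 a) mem_pblock covP aU /=.
case: mR => m pm; apply: (@pairing_even _ e _ m) => // v.
rewrite !inE => /andP[va vB].
have vU : v \in ~: U.
  by rewrite -covP; apply/bigcupP; exists (pblock P a); rewrite ?pblock_mem ?covP.
have vR : v \notin R.
  apply: contra va => vR; apply/eqP/injR => //.
  by apply/same_pblock.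
have [|mv mmv ev] := pm v; first by rewrite inE vR.
move: mv; rewrite inE => /andP[mvR mvU]; split=> //.
apply/andP; split; first by apply: contraNneq mvR => ->.
by rewrite -(same_pblock tiP vB) (pb_e _ _ vU mvU ev) mem_pblock covP.
Qed.

(** Edges are added as long as no perfect matching appears, by induction on the number of
    non-adjacent pairs; a barrier of the larger graph is one of [e]. *)
Theorem tutte_barrier (T : finType) (e : rel T) :
  symmetric e -> irreflexive e -> ~~ odd #|T| -> ~ matchable e setT ->
  exists S P, barrier e S P.
Proof.
have [n] := ubnP #|[set p : T * T | ~~ e p.1 p.2]|.
elim: n e => // n IHn e ltn es ei evT nM.
have [H|] := pselect (forall x z, x != z -> ~~ e x z -> matchable (add_edge e x z) setT).
  exact: saturated_barrier.
move=> /existsNP[x /existsNP[z /not_implyP[xz /not_implyP[nexz nM']]]].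
have [|||||S [P [pP eP oP]]] := IHn (add_edge e x z) => //.
- suff /proper_card : [set p | ~~ add_edge e x z p.1 p.2] \proper [set p | ~~ e p.1 p.2].
    by move=> ltp; apply: leq_trans ltp _.
  apply/properP; split; first by apply/subsetP=> -[u v]; rewrite !inE negb_or => /andP[].
  by exists (x, z); rewrite !inE /add_edge /= ?eqxx ?orbT.
- by move=> u v; rewrite /add_edge es [(v == x) && _]andbC [(v == z) && _]andbC [X in _ || X]orbC.
- move=> u; rewrite /add_edge ei /=; apply/negbTE/negP.
  by case/orP=> /andP[/eqP-> /eqP E]; rewrite E eqxx in xz.
exists S, P; split=> // u v uS vS euv.
by apply: eP; rewrite // /add_edge euv.
Qed.

(** * The Rayleigh quotient *)

Section Spectral.
Local Open Scope ring_scope.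
Local Open Scope sesquilinear_scope.

(** Over the algebraically closed field [R[i]] the symmetric matrix is unitarily diagonalisable, and
    in an orthonormal eigenbasis the inequality holds term by term. *)
Lemma rayleigh_le (R : rcfType) n (A : 'M[R]_n) (l : R) (x : 'rV[R]_n) :
  A^T = A -> (forall mu, eigenvalue A mu -> mu <= l) ->
  (x *m A *m x^T) 0 0 <= l * (x *m x^T) 0 0.
Proof.
move=> symA lmax; pose f : {rmorphism R -> R[i]} := real_complex R.
pose A' := map_mx f A; pose x' := map_mx f x.
pose P := spectralmx A'; pose sp := spectral_diag A'.
have conjf a : Num.conj (f a) = f a by exact: conjc_real.
have hA : A' \is hermsymmx.
  apply/is_hermitianmxP; rewrite expr0 scale1r; apply/matrixP=> i j.
  by rewrite !mxE conjf -[in LHS]symA mxE.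
have Pu : P \is unitarymx := spectral_unitarymx A'.
have defA : A' = P^t* *m diag_mx sp *m P.
  by rewrite -(invmx_unitary Pu); apply/orthomx_spectralP/hermitian_normalmx.
have PP : P *m P^t* = 1%:M by apply/unitarymxP.
(* A diagonal entry is real, hence the image of an eigenvalue of [A] over [R]. *)
have spl i : sp 0 i <= f l.
  have : sp 0 i \is Num.real by have /mxOverP := hermitian_spectral_diag_real hA; apply.
  move=> /complex_realP[a spE]; rewrite spE lecR; apply: lmax.
  rewrite eigenvalue_root_char -(fmorph_root f) map_char_poly -eigenvalue_root_char.
  apply/eigenvalueP; exists (row i P).
    rewrite -row_mul -/A' defA !mulmxA PP mul1mx row_mul -[f a]spE.
    by apply/rowP=> j; rewrite row_diag_mx -scalemxAl -rowE.
  apply/negP=> /eqP Pi0; have /matrixP/(_ i i) := PP.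
  have /rowP := Pi0 => Pi; rewrite !mxE big1 ?eqxx => [/eqP|j _].
    by rewrite eq_sym oner_eq0.
  by have := Pi j; rewrite !mxE => ->; rewrite mul0r.
pose y := x' *m P^t*.
have xT : x'^T = x'^t* by apply/matrixP=> i j; rewrite !mxE conjf.
have yT : y^t* = P *m x'^T.
  by rewrite /y trmx_mul map_mxM trmxCK -xT.
have xPPx : x' *m x'^T = y *m y^t*.
  rewrite yT /y mulmxA -(mulmxA x') (_ : P^t* *m P = 1%:M) ?mulmx1 //.
  exact: mulmx1C.
suff H : f ((x *m A *m x^T) 0 0) <= f l * f ((x *m x^T) 0 0) by rewrite -lecR rmorphM.
have fE B : f ((x *m B *m x^T) 0 0) = (x' *m map_mx f B *m x'^T) 0 0.
  by rewrite map_trmx -!map_mxM [RHS]mxE.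
have fE1 : f ((x *m x^T) 0 0) = (x' *m x'^T) 0 0.
  by rewrite map_trmx -!map_mxM [RHS]mxE.
rewrite fE fE1 xPPx -/A' defA.
rewrite !mulmxA -/y -(mulmxA _ P) -yT !mxE mulr_sumr; apply: ler_sum => j _.
have -> : (y *m diag_mx sp) 0 j = sp 0 j * y 0 j by rewrite mul_mx_diag mxE mulrC.
have -> : (y^t*) j 0 = Num.conj (y 0 j) by rewrite mxE [X in Num.conj X]mxE.
rewrite -mulrA; apply: ler_wpM2r (spl j); apply: mul_conjC_ge0.
Qed.

End Spectral.

(** * Distances and the quadratic form *)

Lemma dist_refl n (adj : rel 'I_n) u : dist adj u u = 0.
Proof. by case: n adj u => [|n] adj u; [case: u | rewrite /dist /= eqxx]. Qed.

Lemma dist_gt0 n (adj : rel 'I_n) u v : u != v -> 0 < dist adj u v.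
Proof.
by case: n adj u v => [|n] adj u v; [case: u | rewrite /dist /= => /negPf->].
Qed.

Lemma reach_within1 n (adj : rel 'I_n) u v :
  reach_within adj 1 u v = (u == v) || adj u v.
Proof.
congr (_ || _); apply/existsP/idP => [[w /andP[uw /eqP<-]]//|uv].
by exists v; rewrite uv eqxx.
Qed.

Lemma dist_gt1 n (adj : rel 'I_n) u v : u != v -> ~~ adj u v -> 1 < dist adj u v.
Proof.
case: n adj u v => [|[|n]] adj u v; [by case: u | by rewrite !ord1 eqxx|].
move=> uv nuv; have := reach_within1 adj u v; rewrite (negPf uv) (negPf nuv) /= (negPf uv) /= => r1.
by rewrite /dist /= (negPf uv) /= r1.
Qed.

Lemma dist_adj n (adj : rel 'I_n) u v : u != v -> adj u v -> dist adj u v = 1.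
Proof.
case: n adj u v => [|[|n]] adj u v; [by case: u | by rewrite !ord1 eqxx|].
move=> uv auv; have := reach_within1 adj u v; rewrite (negPf uv) auv /= (negPf uv) /= => r1.
by rewrite /dist /= (negPf uv) /= r1.
Qed.

(** [dist] only searches lengths below [n]; the three distinct vertices [u], [v], [w] put length 2
    in that range. *)
Lemma dist_common n (adj : rel 'I_n) u v w :
  irreflexive adj -> u != v -> ~~ adj u v -> adj u w -> adj w v -> dist adj u v = 2.
Proof.
move=> ai uv nuv uw wv; have n3 : 2 < n.
  have uNw : u != w by apply: contraTneq uw => ->; rewrite ai.
  have vNw : v != w by apply: contraTneq wv => ->; rewrite ai.
  have := max_card [set u; v; w]; rewrite card_ord; apply: leq_trans.
  by rewrite -setUA cardsU1 cards2 !inE negb_or uv uNw vNw.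
case: n adj u v w ai uv nuv uw wv n3 => [|[|[|n]]] adj u v w // ai uv nuv uw wv _.
have := reach_within1 adj u v; rewrite (negPf uv) (negPf nuv) /= (negPf uv) /= => r1.
rewrite /dist /= (negPf uv) /= r1 /=.
suff -> : [exists w0, adj u w0 &&
   ((w0 == v) || [exists w1, adj w0 w1 && (w1 == v)])] by [].
apply/existsP; exists w; rewrite uw /=; apply/orP; right.
by apply/existsP; exists v; rewrite wv eqxx.
Qed.

(** [reach_within] peels off the first step of a walk; peeling off the last one instead gives the
    symmetry of [dist]. *)
Lemma reach_within_last n (adj : rel 'I_n) m u v :
  reach_within adj m.+1 u v =
  reach_within adj m u v || [exists w, reach_within adj m u w && adj w v].
Proof.
elim: m u v => [|m IHm] u v.
  rewrite reach_within1 /=; congr (_ || _); apply/idP/existsP => [uv|[w /andP[/eqP->]]//].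
  by exists u; rewrite eqxx.
have E k a b : reach_within adj k.+1 a b =
  reach_within adj k a b || [exists w, adj a w && reach_within adj k w b] by [].
rewrite E [in RHS]E IHm; apply/orP/orP => -[].
- case/orP=> [H|/existsP[w /andP[uw wv]]]; first by left; apply/orP; left.
  by right; apply/existsP; exists w; rewrite E uw.
- case/existsP=> w; rewrite IHm => /andP[uw /orP[wv|/existsP[t /andP[wt tv]]]].
    by left; apply/orP; right; apply/existsP; exists w; rewrite uw.
  right; apply/existsP; exists t; rewrite tv E andbT; apply/orP; right.
  by apply/existsP; exists w; rewrite uw.
- case/orP=> [H|/existsP[w /andP[uw wv]]]; first by left; rewrite H.
  by right; apply/existsP; exists w; rewrite uw IHm wv.
case/existsP=> w /andP[]; rewrite E => /orP[uw|/existsP[t /andP[ut tw]]] wv.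
  by left; apply/orP; right; apply/existsP; exists w; rewrite uw.
right; apply/existsP; exists t; rewrite ut IHm; apply/orP; right.
by apply/existsP; exists w; rewrite tw.
Qed.

Lemma dist_sym n (adj : rel 'I_n) u v : symmetric adj -> dist adj u v = dist adj v u.
Proof.
move=> sa; apply: eq_find => m; elim: m u v => [|m IHm] u v; first exact: eq_sym.
rewrite reach_within_last /= IHm; congr (_ || _).
by apply: eq_existsb => w; rewrite IHm sa andbC.
Qed.

Section QuadraticForm.
Local Open Scope ring_scope.

Lemma dist_form_le (R : realType) n (adj : rel 'I_n) (l : R) (x : 'I_n -> R) :
  symmetric adj -> largest_eigenvalue (dist_mx R adj) l ->
  \sum_u \sum_v x u * x v * (dist adj u v)%:R <= l * \sum_u x u ^+ 2.
Proof.
move=> sa [_ lmax]; have sD : (dist_mx R adj)^T = dist_mx R adj.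
  by apply/matrixP=> i j; rewrite !mxE dist_sym.
have := rayleigh_le (\row_i x i) sD lmax.
congr (_ <= _ * _); rewrite mxE; last first.
  by apply: eq_bigr => i _; rewrite !mxE.
rewrite [RHS]exchange_big; apply: eq_bigr => v _; rewrite !mxE big_distrl.
by apply: eq_bigr => u _; rewrite !mxE mulrAC.
Qed.

(** Every ordered pair of distinct vertices counts at least once, and a pair from distinct blocks at
    least twice, because its distance is at least 2. *)
Lemma dist_form_partition (R : realType) n (adj : rel 'I_n) (x : 'I_n -> R)
    (S : {set 'I_n}) (P : {set {set 'I_n}}) :
  partition P (~: S) ->
  (forall u v, u \notin S -> v \notin S -> adj u v -> pblock P u = pblock P v) ->
  (forall u, 0 <= x u) ->
  (\sum_u x u) ^+ 2 - \sum_u x u ^+ 2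
    + (\sum_(u in ~: S) x u) ^+ 2 - \sum_(B in P) (\sum_(u in B) x u) ^+ 2
  <= \sum_u \sum_v x u * x v * (dist adj u v)%:R.
Proof.
move=> pP aP x0.
have tiP : trivIset P by case/and3P: pP.
have covP : cover P = ~: S by apply: cover_partition.
have blockE u : u \in ~: S ->
    \sum_(v in ~: S) (if pblock P u == pblock P v then x u * x v else 0) =
    x u * \sum_(v in pblock P u) x v.
  move=> uS; rewrite mulr_sumr -big_mkcondr; apply: eq_bigl => v.
  apply/andP/idP => [[vS /eqP ->]|vu]; first by rewrite mem_pblock covP.
  rewrite (same_pblock tiP vu) eqxx; split=> //.
  by rewrite -covP; apply/bigcupP; exists (pblock P u); rewrite ?pblock_mem ?covP.
have -> : \sum_(B in P) (\sum_(u in B) x u) ^+ 2 =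
   \sum_(u in ~: S) \sum_(v in ~: S) (if pblock P u == pblock P v then x u * x v else 0).
  rewrite (eq_bigr _ blockE) (set_partition_big _ pP) /=; apply: eq_bigr => B BP.
  by rewrite expr2 mulr_suml; apply: eq_bigr => u uB; rewrite (def_pblock tiP BP uB).
have sqE (A : {set 'I_n}) : (\sum_(u in A) x u) ^+ 2 = \sum_(u in A) \sum_(v in A) x u * x v.
  by rewrite expr2 big_distrl; apply: eq_bigr => u _; rewrite big_distrr.
have -> : (\sum_u x u) ^+ 2 = \sum_u \sum_v x u * x v.
  by rewrite expr2 big_distrl; apply: eq_bigr => u _; rewrite big_distrr.
have -> : \sum_u x u ^+ 2 = \sum_u \sum_v (if u == v then x u * x v else 0).
  apply: eq_bigr => u _; by rewrite -big_mkcond (big_pred1 u) ?expr2.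
rewrite sqE -addrA -!sumrB [X in _ + X](big_mkcond (fun u => u \in ~: S)) -big_split.
apply: ler_sum => u _; rewrite -!sumrB.
have -> : (if u \in ~: S
   then \sum_(v in ~: S) (x u * x v - (if pblock P u == pblock P v then x u * x v else 0))
   else 0) = \sum_v (if (u \in ~: S) && (v \in ~: S) then
      (x u * x v - (if pblock P u == pblock P v then x u * x v else 0)) else 0).
  by case: ifP => uS /=; [rewrite -big_mkcond | rewrite big1].
rewrite -big_split; apply: ler_sum => v _ /=.
have xx0 : 0 <= x u * x v by apply: mulr_ge0.
have [->|uv] := eqVneq u v.
  by rewrite subrr add0r dist_refl mulr0 eqxx subrr if_same.
rewrite subr0.
have d1 : x u * x v <= x u * x v * (dist adj u v)%:R.
  by rewrite ler_peMr // ler1n dist_gt0.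
case: ifP => [/andP[uS vS]|_]; last by rewrite addr0.
case: eqP => [_|nuv]; first by rewrite subrr addr0.
rewrite subr0 -mulr2n -[X in X <= _]mulr_natr; apply: ler_wpM2l => //.
rewrite ler_nat dist_gt1 //.
by apply: contra_notN nuv; apply: aP; rewrite -in_setC.
Qed.
End QuadraticForm.

(** * Sums of squares of block sizes *)

(** By convexity the worst case has [q] parts, all but one of size 1. The proof writes each part as
    1 plus an excess; the squares of the excesses sum to at most the square of the total excess
    [M]. *)
Lemma sum_sqr_le (T : finType) (P : {set T}) (f : T -> nat) (q : nat) :
  (forall B, B \in P -> 0 < f B) -> 0 < q <= #|P| ->
  \sum_(B in P) f B ^ 2 < (\sum_(B in P) f B - q + 1) ^ 2 + q.
Proof.
move=> f0 /andP[q0 qP].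
pose M := \sum_(B in P) (f B).-1.
have sumE : \sum_(B in P) f B = M + #|P|.
  rewrite -sum1_card -big_split; apply: eq_bigr => B /f0 fB /=; lia.
have sqE : \sum_(B in P) f B ^ 2 = \sum_(B in P) (f B).-1 ^ 2 + 2 * M + #|P|.
  rewrite -sum1_card big_distrr -!big_split; apply: eq_bigr => B /f0 fB /=.
  by case: (f B) fB => //= k _; lia.
have leM : \sum_(B in P) (f B).-1 ^ 2 <= M ^ 2.
  rewrite -[M ^ 2]/(M * M) {2}/M big_distrr /=; apply: leq_sum => B BP.
  by rewrite leq_mul // /M (bigD1 B) //= leq_addr.
rewrite sumE sqE; nia.
Qed.

(** * Extremal graphs *)

(** The equitable partition into dominating vertex, clique and the two pendant vertices, used both
    for the quotient equations and for building embeddings. *)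
Definition H_part n (i : 'I_n) : nat :=
  if i == 0 :> nat then 0 else if (i <= n - 3)%N then 1 else 2.

Lemma H_partE n (i j : 'I_n) : K1_join_Kn3_2K1 i j =
  (i != j) && [|| H_part i == 0, H_part j == 0 | (H_part i == 1) && (H_part j == 1)].
Proof.
rewrite /K1_join_Kn3_2K1 /H_part; congr (_ && _).
by case: (i == 0 :> nat); case: (j == 0 :> nat) => //; case: (i <= _)%N; case: (j <= _)%N.
Qed.

Lemma H_part_lt3 n (i : 'I_n) : (H_part i < 3)%N.
Proof. by rewrite /H_part; case: ifP => // _; case: ifP. Qed.

Lemma card_H_part n : (3 <= n)%N ->
  [/\ #|[set i : 'I_n | H_part i == 0]| = 1,
      #|[set i : 'I_n | H_part i == 1]| = (n - 3)%N
    & #|[set i : 'I_n | H_part i == 2]| = 2].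
Proof.
case: n => [|[|[|n]]] // _; set A0 := [set _ | _]; set A1 := [set _ | _]; set A2 := [set _ | _].
have c0 : #|A0| = 1.
  apply/eqP/cards1P; exists ord0; apply/setP=> i; rewrite !inE /H_part -val_eqE /=.
  by case: (i == 0 :> nat) => //; case: (_ <= _).
have c2 : #|A2| = 2.
  have -> : A2 = [set inord n.+1; inord n.+2].
    apply/setP=> i; rewrite !inE /H_part -!val_eqE /= !inordK //.
    have := ltn_ord i; case: (nat_of_ord i =P 0) => [->//|]; case: (leqP i (n.+3 - 3)) => /=; lia.
  by rewrite cards2 -val_eqE /= !inordK // ltn_eqF.
have I02 : A0 :&: A2 = set0.
  by apply/setP=> i; rewrite !inE; case: (H_part i) => [|[|[|]]].
have defA1 : A1 = ~: (A0 :|: A2).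
  by apply/setP=> i; rewrite !inE; have := H_part_lt3 i; case: (H_part i) => [|[|[|]]].
clearbody A0 A1 A2; split=> //.
by rewrite defA1 cardsCs setCK card_ord cardsU c0 c2 I02 cards0.
Qed.

Lemma H_symmetric n : symmetric (@K1_join_Kn3_2K1 n).
Proof.
by move=> i j; rewrite !H_partE eq_sym orbCA [(H_part j == 1) && _]andbC.
Qed.

Lemma H_irreflexive n : irreflexive (@K1_join_Kn3_2K1 n).
Proof. by move=> i; rewrite H_partE eqxx. Qed.

Section Extremal.
Local Open Scope ring_scope.

(** Constant test vector, with [S] the whole vertex set and the empty partition: only the fact that
    distances are at least 1 is used. *)
Lemma largest_eigenvalue_ge (R : realType) n (adj : rel 'I_n) (l : R) :
  symmetric adj -> largest_eigenvalue (dist_mx R adj) l -> n%:R - 1 <= l.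
Proof.
case: n adj => [|n] adj sa ll.
  case: ll => /eigenvalueP[v _ /eqP[]]; exact: thinmx0.
have := dist_form_le (fun=> 1) sa ll; set D := \sum_u _ => le1.
have pP : partition set0 (~: [set: 'I_n.+1]).
  by rewrite setCT; apply/and3P; split; rewrite ?inE // /trivIset /cover !big_set0 ?cards0.
have le2 : n.+1%:R ^+ 2 - n.+1%:R + 0 ^+ 2 - 0 <= D.
  have := @dist_form_partition R _ adj (fun=> 1) _ _ pP.
  rewrite setCT !big_set0 !sumr_const !card_ord !expr1n; apply=> [u v|_]; last exact: ler01.
  by rewrite inE.
have n0 : 0 < n.+1%:R :> R by rewrite ltr0n.
have := le_trans le2 le1; rewrite sumr_const card_ord !expr1n => H.
by rewrite -(ler_pM2r n0); lra.
Qed.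

Definition diameter2 n (adj : rel 'I_n) :=
  forall u v, u != v -> ~~ adj u v -> dist adj u v = 2.

(** In diameter at most 2 the distance matrix is J - I plus the adjacency matrix of the
    complement. *)
Lemma diameter2_sum (R : realType) n (adj : rel 'I_n) (v : 'I_n -> R) j :
  irreflexive adj -> diameter2 adj ->
  \sum_i v i * (dist adj i j)%:R =
  \sum_i v i - v j + \sum_(i | (i != j) && ~~ adj i j) v i.
Proof.
move=> ai d2.
have -> : v j = \sum_i (if i == j then v i else 0).
  by rewrite -big_mkcond (big_pred1 j).
rewrite -sumrB [X in _ + X]big_mkcond -big_split; apply: eq_bigr => i _ /=.
have [->|ij] := eqVneq i j; first by rewrite dist_refl mulr0 subrr addr0.
have [aij|nij] := boolP (adj i j); first by rewrite dist_adj // mulr1 subr0 addr0.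
by rewrite d2 //= subr0 -mulr2n mulr_natr.
Qed.

(** Positivity of all products says that the coordinates are nonzero with a common sign, which
    avoids normalising the sign of the Perron vector. *)
Definition positive_eigenpair (R : realType) n (adj : rel 'I_n) (l : R)
    (v : 'I_n -> R) :=
  (forall i j, 0 < v i * v j) /\
  (forall j, \sum_i v i * (dist adj i j)%:R = l * v j).

(** The Perron vector of [adjH], transported by [s], is a test vector for [adj]. Distances in [adj]
    dominate those in [adjH], strictly at a missing edge; one exists, since otherwise [s] is an
    isomorphism. *)
Lemma subgraph_lt (R : realType) n (adj adjH : rel 'I_n) (l lH : R) v (s : {perm 'I_n}) :
  simple_graph adj -> irreflexive adjH -> diameter2 adjH ->
  largest_eigenvalue (dist_mx R adj) l -> positive_eigenpair adjH lH v ->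
  (forall i j, adj i j -> adjH (s i) (s j)) -> ~ graph_iso adj adjH -> lH < l.
Proof.
move=> [sa ia] iH d2 ll [v0 vE] sub niso.
have dle i j : (dist adjH (s i) (s j) <= dist adj i j)%N.
  have [->|ij] := eqVneq i j; first by rewrite dist_refl.
  have sij : s i != s j by rewrite (inj_eq perm_inj).
  have [aij|nij] := boolP (adjH (s i) (s j)); first by rewrite dist_adj // dist_gt0.
  by rewrite d2 // dist_gt1 //; apply: contra nij => /sub.
have [i [j [nij aij]]] : exists i, exists j, ~~ adj i j /\ adjH (s i) (s j).
  apply: contrapT => H; apply: niso; exists s => i j.
  apply/idP/idP => [/sub//|aH]; apply: contrapT => /negP na.
  by apply: H; exists i, j.
have dlt : (dist adjH (s i) (s j) < dist adj i j)%N.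
  have ij : i != j by apply: contraTneq aij => ->; rewrite iH.
  by rewrite dist_adj ?(inj_eq perm_inj) // dist_gt1.
have sq0 : 0 < \sum_u v (s u) ^+ 2.
  rewrite (bigD1 i) //= ltr_pwDl // ?expr2 //; apply: sumr_ge0 => u _; exact: sqr_ge0.
rewrite -(ltr_pM2r sq0); apply: lt_le_trans (dist_form_le (fun u => v (s u)) sa ll).
have -> : lH * \sum_u v (s u) ^+ 2 =
    \sum_u \sum_w v (s u) * v (s w) * (dist adjH (s u) (s w))%:R.
  rewrite mulr_sumr exchange_big; apply: eq_bigr => w _ /=.
  transitivity (\sum_u v u * v (s w) * (dist adjH u (s w))%:R).
    rewrite expr2 mulrA -vE mulr_suml; apply: eq_bigr => u _.
    by rewrite mulrAC.
  exact: (reindex_inj (@perm_inj _ s)).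
have tle u w : v (s u) * v (s w) * (dist adjH (s u) (s w))%:R <=
    v (s u) * v (s w) * (dist adj u w)%:R.
  by rewrite ler_pM2l // ler_nat.
rewrite (bigD1 i) // [ltRHS](bigD1 i) //= ltr_leD //.
  rewrite (bigD1 j) // [ltRHS](bigD1 j) //= ltr_leD ?ler_sum //.
  by rewrite ltr_pM2l // ltr_nat.
by apply: ler_sum => u _; apply: ler_sum.
Qed.

Lemma eigenvector_coord (R : realType) n (adj : rel 'I_n) (l : R) :
  eigenvalue (dist_mx R adj) l ->
  exists2 v : 'I_n -> R, (exists j, v j != 0) &
    forall j, \sum_i v i * (dist adj i j)%:R = l * v j.
Proof.
case/eigenvalueP=> v vE v0; exists (v 0); first exact/rV0Pn.
move=> j; have /rowP/(_ j) := vE; rewrite !mxE => <-.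
by apply: eq_bigr => i _; rewrite mxE.
Qed.

Lemma H_diameter2 n : diameter2 (@K1_join_Kn3_2K1 n).
Proof.
case: n => [[]//|n] i j ij nij.
have [i0 j0] : i != ord0 /\ j != ord0.
  move: nij; rewrite /K1_join_Kn3_2K1 ij !negb_or => /and3P[i0 j0 _].
  by rewrite -!val_eqE.
apply: (dist_common (@H_irreflexive _) ij nij (w := ord0)).
  by rewrite /K1_join_Kn3_2K1 i0 orbT.
by rewrite /K1_join_Kn3_2K1 eq_sym j0.
Qed.

(** The eigenvalue equations force a constant value on each part, so the part sums satisfy a linear
    system; the cubic is the characteristic polynomial of the quotient matrix. *)
Lemma H_eigenpair (R : realType) n (l : R) : (4 <= n)%N ->
  largest_eigenvalue (dist_mx R (@K1_join_Kn3_2K1 n)) l ->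
  l ^+ 3 - (n%:R - 2) * l ^+ 2 - (7 * n%:R - 17) * l - (4 * n%:R - 10) = 0 /\
  exists v, positive_eigenpair (@K1_join_Kn3_2K1 n) l v.
Proof.
move=> n4 ll; have l0 : 0 < l.
  have := largest_eigenvalue_ge (@H_symmetric n) ll.
  by apply: lt_le_trans; rewrite subr_gt0 ltr1n; lia.
have [v [j0 vj0] vE] := eigenvector_coord ll.1.
have [c0 c1 c2] := card_H_part (ltnW n4).
pose s k := \sum_(i | H_part i == k) v i; pose T := \sum_i v i.
have TE : T = s 0%N + s 1%N + s 2%N.
  rewrite /T (bigID (fun i => H_part i == 0%N)) /= -addrA; congr (_ + _).
  rewrite (bigID (fun i => H_part i == 1%N)) /=; congr (_ + _); apply: eq_bigl => i.
    by case: (H_part i) => [|[|]].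
  by have := H_part_lt3 i; case: (H_part i) => [|[|[|]]].
have vE' j : l * v j = T - v j + \sum_(i | (i != j) && ~~ K1_join_Kn3_2K1 i j) v i.
  rewrite -vE; apply: diameter2_sum; [exact: H_irreflexive | exact: H_diameter2].
have v_0 j : H_part j = 0%N -> (l + 1) * v j = T.
  move=> jE; move: (vE' j); rewrite big1 => [|i]; first lra.
  by rewrite H_partE jE eqxx orbT andbT; case: (i == j).
have v_1 j : H_part j = 1%N -> (l + 1) * v j = T + s 2%N.
  move=> jE; move: (vE' j).
  rewrite (eq_bigl (fun i => H_part i == 2%N)) => [|i]; first by rewrite /s; lra.
  rewrite H_partE jE /=; have [->|ij] := eqVneq i j; first by rewrite jE.
  by have := H_part_lt3 i; case: (H_part i) => [|[|[|]]].
have v_2 j : H_part j = 2%N -> (l + 2) * v j = 2 * T - s 0%N.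
  move=> jE; move: (vE' j).
  rewrite (eq_bigl (fun i => (i != j) && (H_part i != 0%N))) => [|i].
    have : T = s 0%N + (v j + \sum_(i | (i != j) && (H_part i != 0%N)) v i).
      rewrite /T (bigID (fun i => H_part i == 0%N)) /= -/(s _); congr (_ + _).
      rewrite (bigD1 j) ?jE //=; congr (_ + _); apply: eq_bigl => i.
      exact: andbC.
    by set z := \sum_(i | _) _; lra.
  rewrite H_partE jE /=; have [->//|ij] := eqVneq i j.
  by case: (H_part i) => [|[|[|]]].
have sE k (a b : R) : (forall j, H_part j = k -> a * v j = b) ->
    a * s k = b *+ #|[set i : 'I_n | H_part i == k]|.
  move=> H; rewrite /s mulr_sumr -sumr_const; apply: eq_big => [i|i /eqP/H //].
  by rewrite inE.
have s0 : (l + 1) * s 0%N = T by rewrite (sE _ _ _ v_0) c0.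
have s1 : (l + 1) * s 1%N = (n%:R - 3) * (T + s 2%N).
  by rewrite (sE _ _ _ v_1) c1 -[LHS]mulr_natl natrB // ltnW.
have s2 : (l + 2) * s 2%N = 2 * (2 * T - s 0%N).
  by rewrite (sE _ _ _ v_2) c2 -[LHS]mulr_natl.
(* A zero total kills the part sums 0 and 2, then every coordinate, because [l + 1] and [l + 2] are
   positive. *)
have T0 : T != 0.
  apply: contraNneq vj0 => T0.
  have z0 : s 0%N = 0 by apply/eqP; move/eqP: s0; rewrite T0 mulf_eq0 => /orP[/eqP|//]; lra.
  have z2 : s 2%N = 0.
    by apply/eqP; move/eqP: s2; rewrite T0 z0 mulr0 subrr mulr0 mulf_eq0 => /orP[/eqP|//]; lra.
  have := H_part_lt3 j0; case jE: (H_part j0) => [|[|[|]]] // _.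
  - by move/eqP: (v_0 _ jE); rewrite T0 mulf_eq0 => /orP[/eqP|//]; lra.
  - by move/eqP: (v_1 _ jE); rewrite T0 z2 addr0 mulf_eq0 => /orP[/eqP|//]; lra.
  by move/eqP: (v_2 _ jE); rewrite T0 z0 mulr0 subrr mulf_eq0 => /orP[/eqP|//]; lra.
split.
  (* [T] times the cubic is a polynomial combination of the four linear relations. *)
  apply: (mulfI T0); rewrite mulr0.
  move: s0 s1 s2 TE; set a := s 0%N; set k := s 1%N; set p := s 2%N => s0 s1 s2 TE.
  transitivity ((l + 1) ^+ 2 * (l + 2) * (T - (a + k + p))
    + ((l + 1) * (l + 2) - 2 * (l + n%:R - 2)) * ((l + 1) * a - T)
    + (l + 1) * (l + 2) * ((l + 1) * k - (n%:R - 3) * (T + p))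
    + (l + 1) * (l + n%:R - 2) * ((l + 2) * p - 2 * (2 * T - a))); first ring.
  by rewrite s0 s1 s2 -TE !subrr !mulr0 !addr0.
(* Multiplying by [T] fixes the sign: every [T * v j] is shown to be positive. *)
have TT : 0 < T * T by rewrite -expr2 exprn_even_gt0.
have l1 : 0 < l + 1 by lra.
have l2 : 0 < l + 2 by lra.
have sT0 : 0 < T * s 0%N by rewrite -(pmulr_rgt0 _ l1) mulrCA s0.
have tT0 : 0 < T * (2 * T - s 0%N).
  rewrite -(pmulr_rgt0 _ l1) mulrCA mulrBr s0.
  have -> : T * ((l + 1) * (2 * T) - T) = (2 * l + 1) * (T * T) by ring.
  by apply: mulr_gt0 => //; lra.
have sT2 : 0 < T * s 2%N.
  by rewrite -(pmulr_rgt0 _ l2) mulrCA s2 mulrCA pmulr_rgt0.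
have vT j : 0 < T * v j.
  have := H_part_lt3 j; case jE: (H_part j) => [|[|[|]]] // _.
  - by rewrite -(pmulr_rgt0 _ l1) mulrCA v_0.
  - by rewrite -(pmulr_rgt0 _ l1) mulrCA v_1 // mulrDr addr_gt0.
  by rewrite -(pmulr_rgt0 _ l2) mulrCA v_2.
exists v; split=> // i j; rewrite -(pmulr_rgt0 _ TT) mulrACA.
exact: mulr_gt0.
Qed.

End Extremal.

(** * The graph S_{n,k} and its Perron vector *)

Lemma S_symmetric n k : symmetric (@S_graph n k).
Proof. by move=> i j; rewrite /S_graph eq_sym orbC. Qed.

Lemma S_irreflexive n k : irreflexive (@S_graph n k).
Proof. by move=> i; rewrite /S_graph eqxx. Qed.

Lemma S_diameter2 n k : 0 < k -> diameter2 (@S_graph n k).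
Proof.
case: n => [_ []//|n] k0 i j ij nij.
move: (nij); rewrite /S_graph ij negb_or /= => /andP[ik jk].
have ne0 (a : 'I_n.+1) : ~~ (a < k) -> a != ord0 by apply: contraNneq => ->.
apply: (dist_common (@S_irreflexive _ _) ij nij (w := ord0)).
  by rewrite /S_graph k0 orbT ne0.
by rewrite /S_graph k0 eq_sym ne0.
Qed.

Lemma card_S_part n k : k <= n -> #|[set i : 'I_n | i < k]| = k.
Proof.
move=> kn; rewrite -sum1dep_card -(big_ord_widen n (fun=> 1) kn).
by rewrite sum1_card card_ord.
Qed.

(** Labellings with equal fibre sizes list the same multiset of labels, so some permutation carries
    one to the other. *)
Lemma perm_of_parts n (f g : 'I_n -> nat) :
  (forall k, #|[set i | f i == k]| = #|[set i | g i == k]|) ->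
  exists s : {perm 'I_n}, forall i, g (s i) = f i.
Proof.
move=> fg; have : perm_eq [tuple f i | i < n] [tuple g i | i < n].
  apply/allP=> k _ /=; apply/eqP; rewrite -!sum1_count !big_map -!enumT !big_enum_cond /=.
  by rewrite !sum1dep_card fg.
case/tuple_permP=> s sE; exists s => i.
have /(congr1 (fun t => nth 0 t i)) := sE.
by rewrite -!tnth_nth !tnth_mktuple.
Qed.

Section Extremal.
Local Open Scope ring_scope.

(** Same method as for [H_eigenpair] with two parts; the quadratic is the characteristic polynomial
    of the quotient matrix, also equal to (l + 1 - k)(l + 2 - 2m) - km for m = n - k. *)
Lemma S_eigenpair (R : realType) n k (l : R) : (0 < k < n)%N ->
  largest_eigenvalue (dist_mx R (@S_graph n k)) l ->
  (l + 1) * (l + 2 - (n - k)%:R) - k%:R * (l + 2 - (n - k)%:R)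
    - (n - k)%:R * (l + 1) = 0 /\
  exists v, positive_eigenpair (@S_graph n k) l v.
Proof.
move=> /andP[k0 kn] ll; have ln := largest_eigenvalue_ge (@S_symmetric n k) ll.
set m := (n - k)%N.
(* From l >= n - 1 >= m; this makes the relation [t2] determine the sign of [t]. *)
have lm : 0 < l + 2 - m%:R.
  have : m%:R + 1 <= n%:R :> R by rewrite natr1 ler_nat /m; lia.
  by lra.
have m0 : 0 < m%:R :> R by rewrite ltr0n subn_gt0.
have l0 : 0 < l.
  apply: lt_le_trans ln; rewrite subr_gt0 ltr1n; lia.
have [v [j0 vj0] vE] := eigenvector_coord ll.1.
pose s := \sum_(i : 'I_n | (i < k)%N) v i; pose t := \sum_(i : 'I_n | ~~ (i < k)%N) v i.
pose T := \sum_i v i.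
have TE : T = s + t by rewrite /T (bigID (fun i : 'I_n => (i < k)%N)).
have vE' j : l * v j = T - v j + \sum_(i | (i != j) && ~~ S_graph k i j) v i.
  rewrite -vE; apply: diameter2_sum; [exact: S_irreflexive | exact: S_diameter2].
have v_1 (j : 'I_n) : (j < k)%N -> (l + 1) * v j = T.
  move=> jE; move: (vE' j); rewrite big1 => [|i]; first lra.
  by rewrite /S_graph jE orbT andbT andbN.
have v_2 (j : 'I_n) : ~~ (j < k)%N -> (l + 2) * v j = T + t.
  move=> jE; move: (vE' j).
  rewrite (eq_bigl (fun i : 'I_n => ~~ (i < k)%N && (i != j))) => [|i].
    have : t = v j + \sum_(i : 'I_n | ~~ (i < k)%N && (i != j)) v i by rewrite /t (bigD1 j).
    by set z := \sum_(i | _) _; lra.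
  by rewrite /S_graph (negPf jE) orbF; case: (i != j); rewrite ?andbF ?andbT.
have s1 : (l + 1) * s = k%:R * T.
  rewrite /s mulr_sumr (eq_bigr _ v_1) sumr_const -[LHS]mulr_natl; congr (_%:R * _).
  by rewrite -[RHS](card_S_part (ltnW kn)); apply: eq_card => i; rewrite !inE.
have t1 : (l + 2) * t = m%:R * (T + t).
  rewrite /t mulr_sumr (eq_bigr _ v_2) sumr_const -[LHS]mulr_natl; congr (_%:R * _).
  transitivity #|[set i : 'I_n | ~~ (i < k)%N]|; first by apply: eq_card => i; rewrite !inE.
  rewrite cardsCs card_ord (_ : ~: _ = [set i : 'I_n | (i < k)%N]).
    by rewrite card_S_part // ltnW.
  by apply/setP=> i; rewrite !inE negbK.
have t2 : (l + 2 - m%:R) * t = m%:R * T by lra.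
have T0 : T != 0.
  apply: contraNneq vj0 => T0.
  have z : t = 0.
    by apply/eqP; move/eqP: t2; rewrite T0 mulr0 mulf_eq0 => /orP[/eqP|//]; lra.
  have [jE|jE] := boolP (j0 < k)%N.
    by move/eqP: (v_1 _ jE); rewrite T0 mulf_eq0 => /orP[/eqP|//]; lra.
  by move/eqP: (v_2 _ jE); rewrite T0 z addr0 mulf_eq0 => /orP[/eqP|//]; lra.
split.
  apply: (mulfI T0); rewrite mulr0.
  transitivity ((l + 1) * (l + 2 - m%:R) * (T - (s + t))
    + (l + 2 - m%:R) * ((l + 1) * s - k%:R * T)
    + (l + 1) * ((l + 2 - m%:R) * t - m%:R * T)); first ring.
  by rewrite s1 t2 -TE !subrr !mulr0 !addr0.
have TT : 0 < T * T by rewrite -expr2 exprn_even_gt0.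
have l1 : 0 < l + 1 by lra.
have l2 : 0 < l + 2 by lra.
have tT : 0 < T * t.
  by rewrite -(pmulr_rgt0 _ lm) mulrCA t2 mulrCA pmulr_rgt0.
have vT j : 0 < T * v j.
  have [jE|jE] := boolP (j < k)%N.
    by rewrite -(pmulr_rgt0 _ l1) mulrCA v_1.
  by rewrite -(pmulr_rgt0 _ l2) mulrCA v_2 // mulrDr addr_gt0.
exists v; split=> // i j; rewrite -(pmulr_rgt0 _ TT) mulrACA.
exact: mulr_gt0.
Qed.

End Extremal.

(** * Lower bounds on the spectral radius *)

Lemma matchable_perfect n (adj : rel 'I_n) k :
  symmetric adj -> matchable adj setT -> perfect_k_matching adj k.
Proof.
move=> sa [m pm].
have im v : m (m v) = v by case: (pm v (in_setT v)).
have em v : adj v (m v) by case: (pm v (in_setT v)).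
exists (fun u v => if v == m u then k else 0); split.
- by move=> u v; rewrite -(inj_eq (can_inj im)) im eq_sym.
- by move=> u v; case: eqP => // ->; rewrite em.
- by move=> u v; case: eqP.
by move=> v; rewrite -big_mkcond big_pred1_eq.
Qed.

(** The number of odd blocks has the parity of [#|~: S|], hence of [#|S|], and exceeds [#|S|], so it
    does so by at least 2. *)
Lemma barrier_card (T : finType) (e : rel T) (S : {set T}) P :
  ~~ odd #|T| -> barrier e S P -> #|S| + 2 <= #|P|.
Proof.
move=> evT [pP _ oP].
have le : #|[set B in P | odd #|B|]| <= #|P|.
  by apply/subset_leq_card/subsetP=> B; rewrite inE => /andP[].
have : odd #|~: S| = odd #|[set B in P | odd #|B|]|.
  rewrite (card_partition pP) -sum1dep_card big_mkcondr /=.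
  apply: (big_ind2 (fun a b => odd a = odd b)) => [//|a b c d ab cd|B _].
    by rewrite !oddD ab cd.
  by case: (odd #|B|).
by have := cardsC S; move: evT oP le; lia.
Qed.

(** If [S] were empty there would be two blocks, each closed under adjacency. *)
Lemma barrier_nonempty (T : finType) (e : rel T) (S : {set T}) P :
  (forall u v, connect e u v) -> ~~ odd #|T| -> barrier e S P -> 0 < #|S|.
Proof.
move=> con evT bP; rewrite card_gt0; apply/negP=> /eqP S0.
have := barrier_card evT bP; case: bP => pP eP _; rewrite S0 cards0 => /card_gt1P[A [B [AP BP AB]]].
have tiP : trivIset P by case/and3P: pP.
have ne C : C \in P -> exists u, u \in C.
  by move=> CP; apply/set0Pn; apply: contraTneq CP => ->; case/and3P: pP.
have [[u uA] [v vB]] := (ne A AP, ne B BP).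
have clA : closed e [pred w | pblock P w == A].
  by move=> x y exy; rewrite !inE (eP x y) // S0 inE.
have := closed_connect clA (con u v); rewrite !inE (def_pblock tiP AP uA) (def_pblock tiP BP vB).
by rewrite eqxx [B == A]eq_sym (negPf AB).
Qed.

Section Final.
Local Open Scope ring_scope.

(** What is kept of a barrier once parity has been converted into a bound on the number of
    blocks. *)
Definition separated n (adj : rel 'I_n) (S : {set 'I_n}) (P : {set {set 'I_n}}) :=
  partition P (~: S) /\
  (forall u v, u \notin S -> v \notin S -> adj u v -> pblock P u = pblock P v).

Lemma separated_sum n (adj : rel 'I_n) S P : separated adj S P ->
  (\sum_(B in P) #|B| + #|S| = n)%N /\ (forall B, B \in P -> (0 < #|B|)%N).
Proof.
move=> [pP _]; split; first by rewrite -(card_partition pP) addnC cardsC card_ord.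
by move=> B BP; rewrite card_gt0; apply: contraTneq BP => ->; case/and3P: pP.
Qed.

Lemma separated_form (R : realType) n (adj : rel 'I_n) S P (l : R) (x : 'I_n -> R) :
  symmetric adj -> separated adj S P -> largest_eigenvalue (dist_mx R adj) l ->
  (forall u, 0 <= x u) ->
  (\sum_u x u) ^+ 2 - \sum_u x u ^+ 2
    + (\sum_(u in ~: S) x u) ^+ 2 - \sum_(B in P) (\sum_(u in B) x u) ^+ 2
  <= l * \sum_u x u ^+ 2.
Proof.
move=> sa [pP aP] ll x0; apply: le_trans (dist_form_le x sa ll).
exact: dist_form_partition.
Qed.

(** The constant test vector: [b] bounds from below the number of ordered pairs in distinct blocks,
    each adding at least 1 to n(n - 1). *)
Lemma uniform_bound (R : realType) n (adj : rel 'I_n) S P (l : R) (b : nat) :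
  symmetric adj -> separated adj S P -> largest_eigenvalue (dist_mx R adj) l ->
  (\sum_(B in P) #|B| ^ 2 + b <= (n - #|S|) ^ 2)%N ->
  n%:R ^+ 2 - n%:R + b%:R <= l * n%:R.
Proof.
move=> sa sP ll bP; have := separated_form sa sP ll (fun=> ler01).
rewrite !sumr_const card_ord !expr1n.
have -> : #|~: S| = (n - #|S|)%N by have := cardsC S; rewrite card_ord; lia.
under eq_bigr do rewrite sumr_const -natrX.
rewrite -natr_sum -natrX; apply: le_trans; move: bP; rewrite -(ler_nat R) natrD natrX; lra.
Qed.

Lemma block_weight (R : realType) n (x : 'I_n -> R) (D : {set 'I_n}) (a : R) :
  (forall u, u \in D -> x u = a) -> \sum_(u in D) x u = a * #|D|%:R.
Proof. by move=> xE; rewrite (eq_bigr (fun=> a)) // sumr_const mulr_natr. Qed.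

(** The second hypothesis is [uniform_bound] with [b] = 6N - 24; the conclusion says that such an
    [l] is not a root of the cubic of [H_eigenpair]. *)
Lemma cubic_gt0 (R : realFieldType) (N l : R) :
  10 <= N -> N ^+ 2 + 5 * N - 24 <= l * N ->
  0 < l ^+ 3 - (N - 2) * l ^+ 2 - (7 * N - 17) * l - (4 * N - 10).
Proof.
move=> N10 lN; have N0 : 0 < N by lra.
have lN3 : N + 13/5 <= l by rewrite -(ler_pM2r N0); nra.
(* After scaling by N^2 this reduces to N^2 - 12 N + 24 >= 0, true from N = 10 on. *)
have key : 7 * N - 13 <= l * (l - N + 2).
  have N2 : 0 < N * N by apply: mulr_gt0.
  rewrite -(ler_pM2r N2).
  have -> : l * (l - N + 2) * (N * N) = (l * N) * (l * N - N ^+ 2 + 2 * N) by ring.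
  set a := l * N in lN *.
  have : (N ^+ 2 + 5 * N - 24) * (7 * N - 24) <= a * (a - N ^+ 2 + 2 * N).
    by apply: ler_pM; nra.
  nra.
have -> : l ^+ 3 - (N - 2) * l ^+ 2 - (7 * N - 17) * l - (4 * N - 10) =
  l * (l * (l - N + 2) - (7 * N - 17)) - (4 * N - 10) by ring.
have : l * 4 <= l * (l * (l - N + 2) - (7 * N - 17)) by apply: ler_wpM2l; lra.
lra.
Qed.

End Final.

Lemma sum_le_card (T : finType) (P : {set T}) (f : T -> nat) :
  (forall B, B \in P -> 0 < f B) -> \sum_(B in P) f B <= #|P| ->
  forall B, B \in P -> f B = 1.
Proof.
move=> f0 le1; have : \sum_(B in P) (f B).-1 = 0.
  have sE : \sum_(B in P) f B = \sum_(B in P) (f B).-1 + #|P|.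
    by rewrite -sum1_card -big_split; apply: eq_bigr => B /f0 fB /=; lia.
  by move: le1; rewrite sE; lia.
move/eqP; rewrite sum_nat_eq0 => /forall_inP z B BP.
by have := z B BP; have := f0 B BP; lia.
Qed.

Lemma singleton_block n (adj : rel 'I_n) S P u v :
  separated adj S P -> u \notin S -> v \notin S -> adj u v -> #|pblock P u| = 1 -> u = v.
Proof.
move=> [pP aP] uS vS uv c1.
have covP : cover P = ~: S by apply: cover_partition.
have uu : u \in pblock P u by rewrite mem_pblock covP inE.
have vu : v \in pblock P u by rewrite (aP u v) // mem_pblock covP inE.
by move/eqP/cards1P: c1 uu vu => [w ->]; rewrite !inE => /eqP-> /eqP->.
Qed.

(** * Weighted bounds and the extremal configurations *)

Section Cases.
Local Open Scope ring_scope.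

Lemma big_setC n (R : realType) (S : {set 'I_n}) (F : 'I_n -> R) :
  \sum_u F u = \sum_(u in S) F u + \sum_(u in ~: S) F u.
Proof.
by rewrite (bigID (mem S)) /=; congr (_ + _); apply: eq_bigl => u; rewrite inE.
Qed.

(** Weight 2 on [S] and 3 elsewhere. For n = 10 and n = 12 with n/2 + 1 singleton blocks, the
    constant vector is too weak. *)
Lemma independent_bound (R : realType) n (adj : rel 'I_n) S P (l s m : R) :
  symmetric adj -> separated adj S P -> largest_eigenvalue (dist_mx R adj) l ->
  (forall B, B \in P -> #|B| = 1)%N -> #|S|%:R = s -> (n - #|S|)%:R = m ->
  (2 * s + 3 * m) ^+ 2 - (4 * s + 9 * m) + (3 * m) ^+ 2 - 9 * m <= l * (4 * s + 9 * m).
Proof.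
move=> sa sP ll P1 sE mE; pose x u : R := if u \in S then 2 else 3.
have cm : #|~: S|%:R = m by rewrite -mE; congr (_%:R); have := cardsC S; rewrite card_ord; lia.
have xS u : u \in S -> x u = 2 by rewrite /x => ->.
have xC u : u \in ~: S -> x u = 3 by rewrite /x inE => /negPf->.
have x0 u : 0 <= x u by rewrite /x; case: ifP.
have := separated_form sa sP ll x0; rewrite !(big_setC S).
rewrite (block_weight xS) (block_weight xC).
rewrite (block_weight (a := 4)) => [|u /xS->]; last by ring.
rewrite (block_weight (a := 9)) => [|u /xC->]; last by ring.
rewrite (eq_bigr (fun=> 9)) => [|B BP]; last first.
  rewrite (block_weight (a := 3)) ?P1 // => [|u uB]; first by ring.
  by apply: xC; rewrite -(cover_partition sP.1); apply/bigcupP; exists B.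
have -> : \sum_(B in P) 9 = 9 * m :> R.
  rewrite sumr_const -[LHS]mulr_natr -cm (card_partition sP.1) (eq_bigr (fun=> 1%N)) //.
  by rewrite sum1_card.
by rewrite sE cm.
Qed.

(** Weight 3 on the two singleton blocks and 2 elsewhere. For n = 8, a = 5 it gives l >= 10, against
    78/8 from the constant vector. *)
Lemma pendant_bound (R : realType) n (adj : rel 'I_n) S P A (l a : R) :
  symmetric adj -> separated adj S P -> largest_eigenvalue (dist_mx R adj) l ->
  #|S| = 1%N -> #|P| = 3 -> A \in P -> (forall B, B \in P -> B != A -> #|B| = 1%N) ->
  #|A|%:R = a ->
  (2 * a + 8) ^+ 2 - (4 * a + 22) + (2 * a + 6) ^+ 2 - (4 * a ^+ 2 + 18) <= l * (4 * a + 22).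
Proof.
move=> sa sP ll S1 P3 AP P1 aE.
have covP : cover P = ~: S := cover_partition sP.1.
pose x u : R := if u \in S :|: A then 2 else 3.
have xS u : u \in S -> x u = 2 by rewrite /x inE => ->.
have xA u : u \in A -> x u = 2 by rewrite /x inE => ->; rewrite orbT.
have xB B u : B \in P -> B != A -> u \in B -> x u = 3.
  move=> BP BA uB; rewrite /x inE.
  have tiP : trivIset P by case/and3P: sP.1.
  have uS : u \in ~: S by rewrite -covP; apply/bigcupP; exists B.
  rewrite inE in uS; rewrite (negPf uS) /=; case: ifP => // uA.
  by rewrite -(def_pblock tiP BP uB) (def_pblock tiP AP uA) eqxx in BA.
have x0 u : 0 <= x u by rewrite /x; case: ifP.
have P2 : #|P :\ A| = 2 by move: P3; rewrite (cardsD1 A) AP => -[].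
have sumB (F : {set 'I_n} -> R) c : (forall B, B \in P -> B != A -> F B = c) ->
    \sum_(B in P) F B = F A + 2 * c.
  move=> FE; rewrite (bigD1 A) //=; congr (_ + _).
  rewrite (eq_bigl (fun B => B \in P :\ A)) => [|B]; last by rewrite !inE andbC.
  rewrite (eq_bigr (fun=> c)) => [|B]; last by rewrite !inE => /andP[BA BP]; apply: FE.
  by rewrite sumr_const P2 mulr_natl.
have := separated_form sa sP ll x0; rewrite !(big_setC S).
rewrite (block_weight xS) S1.
rewrite (block_weight (D := S) (a := 4)) => [|u /xS->]; last by ring.
rewrite S1 !(set_partition_big _ sP.1) /=.
rewrite (sumB _ 3) => [|B BP BA]; last first.
  by rewrite (block_weight (a := 3)) ?P1 ?mulr1 // => u uB; apply: (xB B).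
rewrite (sumB _ 9) => [|B BP BA]; last first.
  rewrite (block_weight (a := 9)) ?P1 ?mulr1 // => u uB.
  by rewrite (xB B) //; ring.
rewrite (sumB _ 9) => [|B BP BA]; last first.
  by rewrite (block_weight (a := 3)) ?P1 // => [|u uB]; [ring | apply: (xB B)].
rewrite (block_weight xA) (block_weight (a := 4)) => [|u /xA->]; last by ring.
by rewrite aE; lra.
Qed.

(** With singleton blocks every edge meets [S], so sending [S] to the first [k] vertices embeds the
    graph in S_{n,k}, and [subgraph_lt] applies. *)
Lemma S_extremal (R : realType) n (adj : rel 'I_n) S P k (l lS : R) :
  simple_graph adj -> separated adj S P -> (forall B, B \in P -> #|B| = 1%N) ->
  #|S| = k -> (0 < k < n)%N ->
  largest_eigenvalue (dist_mx R adj) l ->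
  largest_eigenvalue (dist_mx R (@S_graph n k)) lS ->
  ~ graph_iso adj (@S_graph n k) -> lS < l.
Proof.
move=> sg sP P1 Sk kn ll llS niso; have [_ [v vp]] := S_eigenpair kn llS.
have [i|s sE] := @perm_of_parts n (fun i => i \in S) (fun i => (i < k)%N).
  have cS : #|[set j : 'I_n | (j \in S) == 1%N :> nat]| = #|[set j : 'I_n | (j < k)%N == 1%N :> nat]|.
    rewrite -[LHS]/(#|_|) (_ : [set j | _] = S); last by apply/setP=> j; rewrite !inE; case: (j \in S).
    rewrite Sk -[LHS](@card_S_part n) ?(ltnW (andP kn).2) //.
    by apply: eq_card => j; rewrite !inE; case: (j < k)%N.
  case: i => [|[|i]] //.
    apply/eqP; rewrite -(eqn_add2l #|[set j : 'I_n | (j \in S) == 1%N :> nat]|) {2}cS.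
    have cE (f : 'I_n -> bool) : (#|[set j | f j == 1%N :> nat]| + #|[set j | f j == 0%N :> nat]| = n)%N.
      rewrite -[RHS](card_ord n) -(cardsC [set j | f j == 1%N :> nat]); congr (_ + _)%N.
      by apply: eq_card => j; rewrite !inE; case: (f j).
    by rewrite !cE.
  by apply: eq_card => j; rewrite !inE; case: (j \in S); case: (j < k)%N.
apply: (subgraph_lt (s := s) sg (@S_irreflexive n k) _ ll vp) => //.
  by apply: S_diameter2; case/andP: kn.
have inS i : (s i < k)%N = (i \in S) by have := sE i; case: (i \in S); case: (s i < k)%N.
move=> i j ij; rewrite /S_graph (inj_eq perm_inj) !inS.
have -> /= : i != j by apply: contraTneq ij => ->; rewrite sg.2.
apply: contraT; rewrite negb_or => /andP[iS jS].
have E : i = j.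
  apply: (singleton_block sP iS jS ij); apply: P1.
  by rewrite pblock_mem // (cover_partition sP.1) inE.
by move: ij; rewrite E sg.2.
Qed.

(** [S], [A] and the remaining two vertices match the parts of the extremal graph; an edge outside
    [S] lies within a block, hence within [A]. *)
Lemma H_extremal (R : realType) n (adj : rel 'I_n) S P A (l lH : R) :
  (4 <= n)%N -> simple_graph adj -> separated adj S P -> #|S| = 1%N ->
  A \in P -> #|A| = (n - 3)%N -> (forall B, B \in P -> B != A -> #|B| = 1%N) ->
  largest_eigenvalue (dist_mx R adj) l ->
  largest_eigenvalue (dist_mx R (@K1_join_Kn3_2K1 n)) lH ->
  ~ graph_iso adj (@K1_join_Kn3_2K1 n) -> lH < l.
Proof.
move=> n4 sg sP S1 AP cA P1 ll llH niso; have [_ [v vp]] := H_eigenpair n4 llH.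
have [c0 c1 c2] := card_H_part (ltnW n4).
pose f (i : 'I_n) := if i \in S then 0%N else if i \in A then 1%N else 2%N.
have covP : cover P = ~: S := cover_partition sP.1.
have AS u : u \in A -> u \notin S.
  by move=> uA; rewrite -in_setC -covP; apply/bigcupP; exists A.
have f0 : #|[set i | f i == 0%N]| = 1%N.
  rewrite -S1; apply: eq_card => i; rewrite !inE /f.
  by case: (i \in S) => //; case: (i \in A).
have f1 : #|[set i | f i == 1%N]| = (n - 3)%N.
  rewrite -cA; apply: eq_card => i; rewrite !inE /f.
  by case: (boolP (i \in A)) => [/AS/negPf->//|_]; case: (i \in S).
have f2 : #|[set i | f i == 2%N]| = 2%N.
  have I : S :&: A = set0.
    by apply/setP=> i; rewrite !inE; case: (boolP (i \in A)) => [/AS/negPf->//|_]; rewrite andbF.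
  have -> : [set i | f i == 2%N] = ~: (S :|: A).
    by apply/setP=> i; rewrite !inE /f; case: (i \in S) => //; case: (i \in A).
  by rewrite cardsCs setCK card_ord cardsU S1 cA I cards0; lia.
have [i|s sE] := @perm_of_parts n f (@H_part n).
  case: i => [|[|[|i]]]; rewrite ?c0 ?c1 ?c2 //.
  apply: eq_card => j; rewrite !inE.
  have -> : (H_part j == i.+3) = false by have := H_part_lt3 j; case: (H_part j) => [|[|[|]]].
  by rewrite /f; case: (j \in S) => //; case: (j \in A).
apply: (subgraph_lt (s := s) sg (@H_irreflexive n) (@H_diameter2 n) ll vp) => // i j ij.
rewrite H_partE (inj_eq perm_inj) !sE.
have nij : i != j by apply: contraTneq ij => ->; rewrite sg.2.
rewrite nij /= /f; case: (boolP (i \in S)) => // iS; case: (boolP (j \in S)) => [|jS]; first by rewrite orbT.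
have pe : pblock P i = pblock P j by apply: sP.2.
have pA u : u \notin S -> (u \in A) = (pblock P u == A).
  move=> uS; have tiP : trivIset P by case/and3P: sP.1.
  apply/idP/eqP => [uA|<-]; first exact: def_pblock.
  by rewrite mem_pblock covP inE.
rewrite !pA // -pe; have [//|nA] := eqVneq (pblock P i) A.
case/eqP: nij; apply: (singleton_block sP iS jS ij); apply: P1 => //.
by rewrite pblock_mem // covP inE.
Qed.


(** * Block sizes with and without a giant block *)

(** [A] is kept apart and [sum_sqr_le] is applied with [q] = 2 to the other blocks. *)
Lemma block_squares_le (T : finType) (P : {set {set T}}) (A : {set T}) :
  A \in P -> (2 < #|P|)%N -> (forall B, B \in P -> (0 < #|B|)%N) ->
  (\sum_(B in P) #|B| ^ 2 < #|A| ^ 2 + (\sum_(B in P) #|B| - #|A| - 1) ^ 2 + 2)%N.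
Proof.
move=> AP P3 P0; have P2 : (1 < #|P :\ A|)%N by move: P3; rewrite (cardsD1 A) AP.
have := @sum_sqr_le _ (P :\ A) (fun B => #|B|) 2.
have P0' B : B \in P :\ A -> (0 < #|B|)%N by rewrite !inE => /andP[_ /P0].
rewrite !(big_setD1 A AP) /= => /(_ P0' P2) H.
rewrite -addnA ltn_add2l; apply: leq_trans H _.
have : (2 <= \sum_(B in P :\ A) #|B|)%N.
  apply: leq_trans P2 _; rewrite -sum1_card; apply: leq_sum => B.
  by rewrite !inE => /andP[_ /P0].
set t := (\sum_(_ in _) _)%N => t2.
by rewrite leq_add2r leq_sqr; lia.
Qed.

Lemma pendant_structure (T : finType) (P : {set {set T}}) (A : {set T}) (m : nat) :
  A \in P -> (2 < #|P|)%N -> (forall B, B \in P -> (0 < #|B|)%N) ->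
  (\sum_(B in P) #|B| = m + 2)%N -> (m <= #|A|)%N ->
  [/\ #|A| = m, #|P| = 3 & forall B, B \in P -> B != A -> #|B| = 1%N].
Proof.
move=> AP P3 P0; rewrite (big_setD1 A AP) /= => sE mA.
have cP : #|P| = (#|P :\ A|).+1 by rewrite (cardsD1 A) AP.
have P0' B : B \in P :\ A -> (0 < #|B|)%N by rewrite !inE => /andP[_ /P0].
have le : (#|P :\ A| <= \sum_(B in P :\ A) #|B|)%N.
  by rewrite -sum1_card; apply: leq_sum.
have [am p2 le2] : [/\ #|A| = m, #|P| = 3 & (\sum_(B in P :\ A) #|B| <= #|P :\ A|)%N].
  move: sE mA cP P3 le; move: (\sum_(B in _) _)%N #|A| #|P| #|P :\ A| => t a p q.
  by move=> *; split; lia.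
split=> //.
by move=> B BP BA; apply: (sum_le_card P0' le2); rewrite !inE BA.
Qed.

(** For a block [A] of size a with 2 <= a <= m - 1, the bound of [block_squares_le] is convex in a,
    so it is largest at the ends. For m = n - 3 the result plus 6n - 24 is exactly (n - 1)^2. *)
Lemma squares_no_giant (T : finType) (P : {set {set T}}) (m : nat) :
  (2 < #|P|)%N -> (forall B, B \in P -> (0 < #|B|)%N) ->
  (\sum_(B in P) #|B| = m + 2)%N -> (forall A, A \in P -> (#|A| < m)%N) ->
  (\sum_(B in P) #|B| ^ 2 <= (m - 1) ^ 2 + 9)%N.
Proof.
move=> P3 P0 sumP lt_m.
have [[A [AP A2]]|noA2] : (exists A, A \in P /\ (2 <= #|A|)%N) \/
    (forall A, A \in P -> (#|A| < 2)%N).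
  have [|H] := pselect (exists A, A \in P /\ (2 <= #|A|)%N); first by left.
  by right=> A AP; rewrite ltnNge; apply/negP=> A2; apply: H; exists A.
- have := block_squares_le AP P3 P0; rewrite sumP.
  have := lt_m A AP; move: A2; move: #|A| (\sum_(B in P) #|B| ^ 2)%N => a X a2 am.
  have [i [j [-> ->]]] : exists i j, (a = i + 2 /\ m = i + j + 3)%N.
    by exists (a - 2)%N, (m - a - 1)%N; lia.
  have -> : (i + j + 3 + 2 - (i + 2) - 1 = j + 2)%N by lia.
  have -> : (i + j + 3 - 1 = i + j + 2)%N by lia.
  nia.
have : (\sum_(B in P) #|B| ^ 2 <= m + 2)%N.
  rewrite -sumP; apply: leq_sum => B BP.
  by have := noA2 B BP; have := P0 B BP; case: #|B| => [|[|]].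
by move: (\sum_(B in P) #|B| ^ 2)%N => X; case: m {sumP lt_m} => [|m]; nia.
Qed.

(** * Case analysis on the size of [S] *)

Lemma unmatchable_separated n (adj : rel 'I_n) :
  simple_graph adj -> connected_graph adj -> ~~ odd n -> ~ matchable adj setT ->
  exists S P, [/\ separated adj S P, (0 < #|S|)%N & (#|S| + 2 <= #|P|)%N].
Proof.
move=> [sa ia] con evn nM; have evT : ~~ odd #|'I_n| by rewrite card_ord.
have [S [P bP]] := tutte_barrier sa ia evT nM; exists S, P; split.
- by case: bP.
- exact: barrier_nonempty con evT bP.
exact: barrier_card evT bP.
Qed.

Lemma separated_arith n (adj : rel 'I_n) S P :
  separated adj S P -> (#|S| + 2 <= #|P|)%N ->
  [/\ (#|S| + 2 + #|S| <= n)%N, (\sum_(B in P) #|B| = n - #|S|)%N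
    & (\sum_(B in P) #|B| ^ 2 < (n - #|S| - (#|S| + 2) + 1) ^ 2 + (#|S| + 2))%N].
Proof.
move=> sP Pq; have [sumE P0] := separated_sum sP.
have tE : (\sum_(B in P) #|B| = n - #|S|)%N by rewrite -[X in (X - _)%N]sumE addnK.
have := @sum_sqr_le _ P (fun B => #|B|) (#|S| + 2) P0.
rewrite Pq tE addn_gt0 orbT => /(_ isT) Xle; split=> //.
rewrite -[X in (_ <= X)%N]sumE leq_add2r (leq_trans Pq) //.
by rewrite -sum1_card; apply: leq_sum.
Qed.

(** The complement of [S] has n/2 + 1 vertices, and there are at least that many blocks. *)
Lemma separated_singletons n (adj : rel 'I_n) S P :
  separated adj S P -> (#|S| + 2 <= #|P|)%N -> #|S| = (n./2 - 1)%N -> ~~ odd n ->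
  forall B, B \in P -> #|B| = 1%N.
Proof.
move=> sP Pq Sk evn; have [sumE P0] := separated_sum sP.
apply: sum_le_card => //; apply: leq_trans Pq.
by rewrite -(leq_add2r #|S|) sumE Sk; lia.
Qed.

Lemma matchable_small (R : realType) n (adj : rel 'I_n) (l lS : R) :
  simple_graph adj -> connected_graph adj -> ~~ odd n -> (6 <= n <= 8)%N ->
  largest_eigenvalue (dist_mx R adj) l ->
  largest_eigenvalue (dist_mx R (@S_graph n (n./2 - 1))) lS ->
  l <= lS -> ~ graph_iso adj (@S_graph n (n./2 - 1)) -> matchable adj setT.
Proof.
move=> sg con evn n68 ll llS lle niso; apply: contrapT => nM.
have [S [P [sP S0 Pq]]] := unmatchable_separated sg con evn nM.
have [_ P0] := separated_sum sP; have [sle tE Xle] := separated_arith sP Pq.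
have lb b := @uniform_bound R n adj S P l b sg.1 sP ll.
have kn : (0 < n./2 - 1 < n)%N by lia.
have S_ext : #|S| <> (n./2 - 1)%N.
  move=> Sk; have P1 := separated_singletons sP Pq Sk evn.
  by have := S_extremal sg sP P1 Sk kn ll llS niso; rewrite ltNge lle.
have [] := S_eigenpair kn llS.
have [n6|n8] : n = 6%N \/ n = 8%N by lia.
- subst n; rewrite /= in Xle lb sle S_ext * => sq _.
  have {}sq : (lS + 1) * (lS + 2 - 4) - 2 * (lS + 2 - 4) - 4 * (lS + 1) = 0 by exact: sq.
  have s1 : #|S| = 1%N.
    have s2 : #|S| <> 2%N := S_ext.
    by move: S0 sle s2; move: #|S| => s; lia.
  (* The squares sum to at most 11 and 25 - 11 = 14, so l >= 44/6, where lS^2 - 7 lS - 2 is already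
     positive. *)
  rewrite s1 in Xle lb; have {}lb := lb 14%N ltac:(lia).
  by nra.
subst n; rewrite /= in Xle lb sle S_ext * => sq _.
have {}sq : (lS + 1) * (lS + 2 - 5) - 3 * (lS + 2 - 5) - 5 * (lS + 1) = 0 by exact: sq.
(* The quadratic is lS^2 - 10 lS + 1, whose roots are below 10. A surplus of 24 pairs suffices, as
   (56 + 24)/8 = 10. *)
suff l10 : 10 <= l by nra.
have [s1|s2] : #|S| = 1%N \/ #|S| = 2%N.
- have s3 : #|S| <> 3%N := S_ext.
  by move: S0 sle s3; move: #|S| => s; lia.
- have P3 : (2 < #|P|)%N by rewrite s1 in Pq.
  have sumP : (\sum_(B in P) #|B| = 7)%N by rewrite tE s1.
  have [[A [AP A5]]|noA] := pselect (exists A, A \in P /\ (5 <= #|A|)%N).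
    have [cA cP P1] := @pendant_structure _ P A 5 AP P3 P0 sumP A5.
    by have := pendant_bound sg.1 sP ll s1 cP AP P1 (erefl _); rewrite cA; lra.
  have X25 := @squares_no_giant _ P 5 P3 P0 sumP.
  rewrite s1 in lb.
  have H : (\sum_(B in P) #|B| ^ 2 <= 25)%N.
    by apply: X25 => A AP; rewrite ltnNge; apply/negP=> A5; apply: noA; exists A.
  by have := lb 24%N (leq_add H (leqnn 24)); lra.
by rewrite s2 in lb Xle; have {}lb := lb 24%N ltac:(lia); lra.
Qed.

Lemma matchable_large (R : realType) n (adj : rel 'I_n) (l lH : R) :
  simple_graph adj -> connected_graph adj -> ~~ odd n -> (10 <= n)%N ->
  largest_eigenvalue (dist_mx R adj) l ->
  largest_eigenvalue (dist_mx R (@K1_join_Kn3_2K1 n)) lH ->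
  l <= lH -> ~ graph_iso adj (@K1_join_Kn3_2K1 n) -> matchable adj setT.
Proof.
move=> sg con evn n10 ll llH lle niso; apply: contrapT => nM.
have [S [P [sP S0 Pq]]] := unmatchable_separated sg con evn nM.
have [_ P0] := separated_sum sP; have [sle tE Xle] := separated_arith sP Pq.
have n4 : (4 <= n)%N by apply: leq_trans n10.
have [cub _] := H_eigenpair n4 llH.
have N10 : 10 <= n%:R :> R by rewrite ler_nat.
(* A surplus of 6n - 24 pairs forces lH >= n + 5 - 24/n, where the cubic is positive. *)
have far : (\sum_(B in P) #|B| ^ 2 + (6 * n - 24) <= (n - #|S|) ^ 2)%N -> False.
  move/(uniform_bound sg.1 sP ll); rewrite natrB ?natrM; last by lia.
  move=> lb; have lb' : n%:R ^+ 2 + 5 * n%:R - 24 <= lH * n%:R by nra.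
  by have := cubic_gt0 N10 lb'; rewrite cub ltxx.
have [s1|s2] : #|S| = 1%N \/ (2 <= #|S|)%N.
- by move: S0; case: #|S| => [|[|]]; auto.
- have P3 : (2 < #|P|)%N by rewrite s1 in Pq.
  have sumP : (\sum_(B in P) #|B| = (n - 3) + 2)%N by rewrite tE s1; lia.
  have [[A [AP A5]]|noA] := pselect (exists A, A \in P /\ (n - 3 <= #|A|)%N).
    have [cA cP P1] := pendant_structure AP P3 P0 sumP A5.
    by have := H_extremal n4 sg sP s1 AP cA P1 ll llH niso; rewrite ltNge lle.
  have H : (\sum_(B in P) #|B| ^ 2 <= (n - 3 - 1) ^ 2 + 9)%N.
    apply: squares_no_giant => // A AP.
    by rewrite ltnNge; apply/negP=> A5; apply: noA; exists A.
  apply: far; rewrite s1; move: H; move: (\sum_(B in P) _)%N => X.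
  have [m ->] : exists m, (n = m + 10)%N by exists (n - 10)%N; lia.
  have -> : (m + 10 - 3 - 1 = m + 6)%N by lia.
  have -> : (m + 10 - 1 = m + 9)%N by lia.
  nia.
have [Sk|Sk] := eqVneq #|S| (n./2 - 1)%N; last first.
  (* Here 2 <= s <= n/2 - 2. In the parameters [t] and [u] the slack is at least t^2 + 4tu - t,
     which is nonnegative. *)
  apply: far; move: s2 Sk sle Xle; move: #|S| (\sum_(B in P) _)%N => s X s2 Sk sle.
  have [t [u [-> ->]]] : exists t u, (s = t + 2 /\ n = 2 * t + 2 * u + 8)%N.
    by exists (s - 2)%N, (n./2 - s - 2)%N; lia.
  have -> : (2 * t + 2 * u + 8 - (t + 2) = t + 2 * u + 6)%N by lia.
  have -> : (t + 2 * u + 6 - (t + 2 + 2) + 1 = 2 * u + 3)%N by lia.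
  have -> : (6 * (2 * t + 2 * u + 8) - 24 = 12 * t + 12 * u + 24)%N by lia.
  nia.
have P1 := separated_singletons sP Pq Sk evn.
(* With singleton blocks [far] applies from n = 16 on, where 9 + 72 = 9^2 is an equality. *)
have [n16|n16] := leqP 16 n.
  apply: far; move: Xle; rewrite Sk; move: (\sum_(B in P) _)%N => X.
  have [h ->] : exists h, (n = 2 * h + 16)%N by exists (n./2 - 8)%N; lia.
  have -> : ((2 * h + 16)./2 - 1 = h + 7)%N by lia.
  have -> : (2 * h + 16 - (h + 7) = h + 9)%N by lia.
  have -> : (h + 9 - (h + 7 + 2) + 1 = 1)%N by lia.
  have -> : (6 * (2 * h + 16) - 24 = 12 * h + 72)%N by lia.
  nia.
(* For n = 10, 12, 14 this gives l >= 876/70, 1256/83 and 1704/96, rounded down below to 12.51, 15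
   and 17; from those values on the cubic is positive. *)
have ib := independent_bound sg.1 sP ll P1 (erefl _) (erefl _).
have [nE|[nE|nE]] : n = 10%N \/ n = 12%N \/ n = 14%N by lia.
- subst n; rewrite Sk /= in ib.
  have {}ib : (2 * 4 + 3 * 6) ^+ 2 - (4 * 4 + 9 * 6) + (3 * 6) ^+ 2 - 9 * 6 <= l * (4 * 4 + 9 * 6).
    exact: ib.
  have lH12 : 1251 / 100 <= lH by lra.
  nra.
- subst n; rewrite Sk /= in ib.
  have {}ib : (2 * 5 + 3 * 7) ^+ 2 - (4 * 5 + 9 * 7) + (3 * 7) ^+ 2 - 9 * 7 <= l * (4 * 5 + 9 * 7).
    exact: ib.
  have lH15 : 15 <= lH by lra.
  nra.
subst n; rewrite Sk /= in ib.
have {}ib : (2 * 6 + 3 * 8) ^+ 2 - (4 * 6 + 9 * 8) + (3 * 8) ^+ 2 - 9 * 8 <= l * (4 * 6 + 9 * 8).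
  exact: ib.
have lH17 : 17 <= lH by lra.
nra.
Qed.

End Cases.

Theorem theorem1 (R : realType) (k n : nat) (adj : rel 'I_n) :
  odd k -> 1 <= k ->
  simple_graph adj -> connected_graph adj ->
  ~~ odd n -> 6 <= n ->
  (n <= 8 ->
   forall l lS : R,
     largest_eigenvalue (dist_mx R adj) l ->
     largest_eigenvalue (dist_mx R (@S_graph n (n./2 - 1))) lS ->
     (l <= lS)%R ->
     ~ graph_iso adj (@S_graph n (n./2 - 1)) ->
     perfect_k_matching adj k) /\
  (10 <= n ->
   forall l lH : R,
     largest_eigenvalue (dist_mx R adj) l ->
     largest_eigenvalue (dist_mx R (@K1_join_Kn3_2K1 n)) lH ->
     (l <= lH)%R ->
     ~ graph_iso adj (@K1_join_Kn3_2K1 n) ->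
     perfect_k_matching adj k).
Proof.
move=> _ _ sg con evn n6; split=> [n8 l lS ll llS lle niso|n10 l lH ll llH lle niso].
  apply: (matchable_perfect _ sg.1); apply: (matchable_small sg con evn _ ll llS) => //.
  by rewrite n6.
exact: (matchable_perfect _ sg.1 (matchable_large sg con evn n10 ll llH lle niso)).
Qed.
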